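(* Let $m\geq 3$ and $k\ge 1$ be integers, and let $P_m,\dots,P_{m+k-1}\in\mathbb{Z}[y]$ be polynomials such that the linear combination $a_mP_m+\dots+a_{m+k-1}P_{m+k-1}$ has degree at least $m$ unless $a_m=\dots=a_{m+k-1}=0$ (in particular, $P_m,\dots,P_{m+k-1}$ are linearly independent and each of them has degree at least $m$). Then there exist positive constants $c$, $C$ and $p_1$, depending only on $m$, $k$ and $P_m,\dots,P_{m+k-1}$, such that the following holds. Let $p_0>0$ and let $s_m:[p_0,\infty)\to(0,1]$ be any decreasing function with $s_m(n)\to 0$ as $n\to\infty$ and $r_m(p)\le p\cdot s_m(p)$ for all primes $p\ge p_0$. If $p\ge p_1$ is a prime with $cp^c\ge p_0$, and $A\subset\mathbb{F}_p$ lacks $$x,\; x+y,\;\dots,\; x+(m-1)y,\; x+P_m(y),\;\dots,\; x+P_{m+k-1}(y)$$ with $y\ne 0$ (i.e. there are no $x\in\mathbb{F}_p$, $y\in\mathbb{F}_p\setminus\{0\}$ for which all these elements lie in $A$), then $$|A|\le C\, p\cdot s_m(cp^{c}).$$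
   Context: $\mathbb{F}_p$ is the field with $p$ elements. For a prime $p$, $r_m(p)$ denotes the size of the largest subset of $\mathbb{F}_p$ lacking $m$-term arithmetic progressions, i.e. containing no $x,x+y,\dots,x+(m-1)y$ with $x\in\mathbb{F}_p$ and $y\in\mathbb{F}_p\setminus\{0\}$. Linear combinations of the $P_j$ are taken with real (equivalently integer) coefficients $a_j$. *)

(* Defs.v *)
From HB Require Import structures.
From mathcomp Require Import all_boot all_order all_algebra.
From mathcomp Require Import all_classical all_reals all_analysis.

Set Implicit Arguments.
Unset Strict Implicit.
Unset Printing Implicit Defensive.

Import Order.TTheory GRing.Theory Num.Theory.
Import numFieldNormedType.Exports.

Local Open Scope ring_scope.

(* The definitions below are meant for p prime: for other p, the type 'F_p is
   not the ring of integers mod p. *)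

(* The terms x, x + y, ..., x + (m-1)y need not be distinct when p < m. *)
Definition has_ap (m p : nat) (A : {set 'F_p}) : bool :=
  [exists x : 'F_p, exists y : 'F_p,
    (y != 0) && [forall i : 'I_m, x + y *+ i \in A]].

Definition r_ap (m p : nat) : nat :=
  (\max_(A : {set 'F_p} | ~~ @has_ap m p A) #|A|)%N.

(* P j is the polynomial P_(m+j) of the progression
   x, x + y, ..., x + (m-1)y, x + P_m(y), ..., x + P_(m+k-1)(y). *)
Definition has_poly_progression (m k : nat) (P : 'I_k -> {poly int})
    (p : nat) (A : {set 'F_p}) : bool :=
  [exists x : 'F_p, exists y : 'F_p,
    [&& y != 0,
        [forall i : 'I_m, x + y *+ i \in A] &
        [forall j : 'I_k, x + (map_poly intr (P j)).[y] \in A]]].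

(* Main.v *)
Require Import Defs.
From HB Require Import structures.
From mathcomp Require Import all_boot all_order all_algebra.
From mathcomp Require Import all_classical all_reals all_analysis.
From mathcomp Require Import complex ring lra zify.

Set Implicit Arguments.
Unset Strict Implicit.
Unset Printing Implicit Defensive.

Import Order.TTheory GRing.Theory Num.Theory.
Import numFieldNormedType.Exports.

Local Open Scope ring_scope.

(** The count of progressions in [A] asymptotically factors, with an error
    saving a power of [p]: if [A] has density [alpha], the number of pairs
    [(x, y)] for which all [m + k] points lie in [A] is [alpha ^ k] times the
    number of pairs for which the [m] points [x, ..., x + (m - 1) y] do, up to
    [O(p ^ (2 - c))] ([prog_asymptotics], [count_bound]).  If [A] contains no
    polynomial progression, then [alpha ^ k] times the density of its [m]-term
    arithmetic progressions is therefore at most a negative power of [p].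

    On the other hand, let [q] be a prime that is a small power of [p].  If [A]
    has density larger than [4 * s q], it is dense on many of the short
    arithmetic progressions of length about [q / 2] in the field; each of these
    is Freiman isomorphic to half of the residues modulo [q], so it contains an
    [m]-term progression of [A], and averaging gives at least [p ^ 2 / q ^ 3]
    progressions ([supersaturation], [dense_set_many_aps]).  As [alpha] is at
    least [1 / q], the two bounds contradict each other when [q] is a small
    enough power of [p].  A prime between [X] and a multiple of [X ^ 2] is
    provided by central binomial coefficients ([exists_prime_quadratic]).

    The factorization is proved by degree lowering, one polynomial term at a
    time.  Let [G] be the dual function of the term [x + P(y)], the average
    over [y] of the product of all the other terms, so that the count is the
    correlation of [G] with the indicator function of [A].
    - Repeated applications of Cauchy--Schwarz, organized by a lexicographic
      induction on leading coefficients, bound the count by a uniformity norm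
      of any one of the functions at a polynomial term, of an order depending
      on the polynomials only ([pet], [target_control]).  This applies to
      [G - mean G] itself and bounds its mean square by its uniformity norm.
    - If the uniformity norm of order [s + 1] of a dual function is large, then
      so is that of order [s] ([degree_lowering]): its derivatives of order
      [s - 1] correlate with characters, and by a box Cauchy--Schwarz
      inequality the products of translates of the terms correlate with
      characters whose frequencies are alternating sums of the original ones.
      By induction on the number of terms that are not characters, these
      frequencies must vanish, and then the original frequencies depend on
      fewer variables and can be removed.
    - The induction starts with all the polynomial terms being characters.  The
      linear terms are then removed by Cauchy--Schwarz, and what remains is a
      uniformity norm of the phase of a nontrivial combination of the
      polynomials, which is small since its degree is at least [m]
      ([prog_characters]).
    For [G - mean G] the norm of lowest order is zero, hence all its norms are
    small and so is its mean square ([lowering_chain], [decouple]). *)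

(** * Averages and absolute values *)

Section Averages.
Variable K : numFieldType.
Implicit Types T S : finType.

Definition avg T (f : T -> K) : K := (\sum_t f t) / #|T|%:R.

Local Notation "\avg_ x E" := (avg (fun x => E))
  (at level 36, x binder, E at level 36, right associativity).

Lemma eq_avg T (f g : T -> K) : f =1 g -> avg f = avg g.
Proof. by move=> e; rewrite /avg (eq_bigr _ (fun t _ => e t)). Qed.

Lemma avg_cst T (c : K) : (0 < #|T|)%N -> \avg_(_ : T) c = c.
Proof.
by move=> T0; rewrite /avg sumr_const -[c *+ _]mulr_natr mulfK// pnatr_eq0 -lt0n.
Qed.

Lemma avgD T (f g : T -> K) : \avg_ x (f x + g x) = avg f + avg g.
Proof. by rewrite /avg big_split mulrDl. Qed.

Lemma avgN T (f : T -> K) : \avg_ x (- f x) = - avg f.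
Proof. by rewrite /avg sumrN mulNr. Qed.

Lemma avgB T (f g : T -> K) : \avg_ x (f x - g x) = avg f - avg g.
Proof. by rewrite avgD avgN. Qed.

Lemma avgMl T (c : K) (f : T -> K) : \avg_ x (c * f x) = c * avg f.
Proof. by rewrite /avg -mulr_sumr mulrA. Qed.

Lemma avgMr T (c : K) (f : T -> K) : \avg_ x (f x * c) = avg f * c.
Proof. by rewrite /avg -mulr_suml mulrAC. Qed.

Lemma exchange_avg T S (f : T -> S -> K) :
  \avg_ x (\avg_ y f x y) = \avg_ y (\avg_ x f x y).
Proof. by rewrite /avg -!mulr_suml exchange_big /= mulrAC. Qed.

Lemma avg_pair T S (f : T * S -> K) :
  avg f = \avg_ x (\avg_ y f (x, y)).
Proof.
rewrite /avg -mulr_suml pair_bigA /= card_prod natrM -mulrA -invfM mulrC.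
by rewrite [RHS]mulrC [_%:R * _]mulrC; congr (_ * _); apply: eq_bigr => -[].
Qed.

Lemma reindex_avg T (h : T -> T) (f : T -> K) :
  injective h -> avg f = avg (f \o h).
Proof.
by move=> hI; rewrite /avg (reindex_inj hI).
Qed.

Lemma avgM T S (f : T -> K) (g : S -> K) :
  avg f * avg g = \avg_ x (\avg_ y (f x * g y)).
Proof. by under [RHS]eq_avg do rewrite avgMl; rewrite avgMr. Qed.

Lemma avg_sum T (I : Type) (r : seq I) (f : I -> T -> K) :
  \avg_ x (\sum_(i <- r) f i x) = \sum_(i <- r) avg (f i).
Proof. by rewrite /avg exchange_big /= mulr_suml. Qed.

Lemma le_avg T (f g : T -> K) : (forall x, f x <= g x) -> avg f <= avg g.
Proof. by move=> le_fg; rewrite ler_wpM2r ?invr_ge0 ?ler0n ?ler_sum. Qed.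

Lemma avg_ge0 T (f : T -> K) : (forall x, 0 <= f x) -> 0 <= avg f.
Proof. by move=> f0; rewrite divr_ge0 ?ler0n ?sumr_ge0. Qed.

Lemma avg_le_cst T (f : T -> K) (c : K) :
  (0 < #|T|)%N -> (forall x, f x <= c) -> avg f <= c.
Proof. by move=> T0 le_fc; rewrite -[leRHS](avg_cst c T0) le_avg. Qed.

End Averages.

Notation "\avg_ x E" := (avg (fun x => E))
  (at level 36, x binder, E at level 36, right associativity) : ring_scope.

(** The tangent line of [x ^+ n] at the mean lies below its graph; averaging
    this bound over [f] kills the linear term. *)
Lemma exp_avg_le (K : realFieldType) (T : finType) (f : T -> K) n :
  (0 < #|T|)%N -> (forall x, 0 <= f x) -> avg f ^+ n <= \avg_ x f x ^+ n.
Proof.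
move=> T0 f0; set m := avg f; have m0 : 0 <= m by apply: avg_ge0.
have tangent a : 0 <= a -> m ^+ n + n%:R * m ^+ n.-1 * (a - m) <= a ^+ n.
  move=> a0; elim: n => [|n IHn]; first by rewrite !mul0r addr0.
  rewrite [leRHS]exprS; apply: le_trans (ler_wpM2l a0 IHn).
  have : 0 <= n%:R * m ^+ n.-1 * (a - m) ^+ 2.
    by rewrite mulr_ge0 ?sqr_ge0 // mulr_ge0 ?ler0n ?exprn_ge0.
  case: n {IHn} => [|n] /=; rewrite -?natr1 !exprS ?expr0; first by lra.
  move: (m ^+ n) (n%:R : K) => u v; lra.
apply: (@le_trans _ _ (\avg_ x (m ^+ n + n%:R * m ^+ n.-1 * (f x - m)))).
  by rewrite avgD avgMl avgB !avg_cst// subrr mulr0 addr0.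
by apply: le_avg => x; apply: tangent.
Qed.

Section ComplexAverages.
Variable R : rcfType.
Local Notation C := R[i].
Implicit Types (z w : C) (T S : finType).

(** The modulus with values in [R], where inequalities can be handled by the
    decision procedures for ordered fields. *)
Definition nrm z : R := complex.Re `|z|.

Lemma nrmE z : `|z| = (nrm z)%:C%C.
Proof. by rewrite /nrm normc_def. Qed.

Lemma nrm_ge0 z : 0 <= nrm z.
Proof. by rewrite -lecR -nrmE normr_ge0. Qed.

Lemma nrmM z w : nrm (z * w) = nrm z * nrm w.
Proof. by apply: complexI; rewrite rmorphM /= -!nrmE normrM. Qed.

Lemma nrm1 : nrm 1 = 1.
Proof. by apply: complexI; rewrite -nrmE normr1. Qed.

Lemma nrm0 : nrm 0 = 0.
Proof. by apply: complexI; rewrite -nrmE normr0. Qed.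

Lemma nrmN z : nrm (- z) = nrm z.
Proof. by apply: complexI; rewrite -!nrmE normrN. Qed.

Lemma nrmD z w : nrm (z + w) <= nrm z + nrm w.
Proof. by rewrite -lecR rmorphD /= -!nrmE ler_normD. Qed.

Lemma nrmB z w : nrm (z - w) <= nrm z + nrm w.
Proof. by rewrite -(nrmN w) nrmD. Qed.

Lemma nrm_conj z : nrm z^*%C = nrm z.
Proof. by apply: complexI; rewrite -!nrmE normcJ. Qed.

Lemma nrmR (r : R) : 0 <= r -> nrm r%:C%C = r.
Proof. by move=> r0; apply: complexI; rewrite -nrmE ger0_norm// lecR. Qed.

Lemma nrm_half : nrm (2^-1 : C) = 2^-1.
Proof.
have -> : (2^-1 : C) = (2^-1 : R)%:C%C by rewrite fmorphV rmorph_nat.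
by rewrite nrmR // invr_ge0 ler0n.
Qed.

Lemma nrmX z n : nrm (z ^+ n) = nrm z ^+ n.
Proof. by elim: n => [|n IHn]; rewrite ?expr0 ?nrm1// !exprS nrmM IHn. Qed.

Lemma mul_conj z : z * z^*%C = (nrm z ^+ 2)%:C%C.
Proof. by rewrite -sqr_normc nrmE rmorphXn. Qed.

Lemma nrm_prod_le1 (I : Type) (r : seq I) (P : pred I) (f : I -> C) :
  (forall i, P i -> nrm (f i) <= 1) -> nrm (\prod_(i <- r | P i) f i) <= 1.
Proof.
move=> f1; elim/big_rec: _ => [|i z Pi z1]; first by rewrite nrm1.
by rewrite nrmM mulr_ile1 ?nrm_ge0 ?f1.
Qed.

Lemma nrmM_le1 z w : nrm z <= 1 -> nrm w <= 1 -> nrm (z * w) <= 1.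
Proof. by move=> *; rewrite nrmM mulr_ile1 ?nrm_ge0. Qed.

Lemma conj_avg T (f : T -> C) : (avg f)^*%C = \avg_ x (f x)^*%C.
Proof.
by rewrite /avg rmorphM rmorph_sum /= conjc_inv conjc_nat.
Qed.

Lemma real_avg T (f : T -> R) : (avg f)%:C%C = \avg_ x (f x)%:C%C.
Proof. by rewrite /avg rmorphM rmorph_sum /= fmorphV rmorph_nat. Qed.

Lemma nrm_avg T (f : T -> C) : nrm (avg f) <= \avg_ x nrm (f x).
Proof.
rewrite -lecR real_avg -nrmE /avg normrM normfV normr_nat.
rewrite ler_wpM2r ?invr_ge0 ?ler0n//.
by rewrite (eq_bigr _ (fun x _ => esym (nrmE (f x)))) ler_norm_sum.
Qed.

Lemma nrm_avg_le1 T (f : T -> C) :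
  (0 < #|T|)%N -> (forall x, nrm (f x) <= 1) -> nrm (avg f) <= 1.
Proof. by move=> T0 f1; apply: le_trans (nrm_avg _) _; apply: avg_le_cst. Qed.

(** Cauchy--Schwarz in the form used throughout, to discard a bounded weight. *)
Lemma avg_weight_sqr T (g k : T -> C) :
    (0 < #|T|)%N -> (forall x, nrm (g x) <= 1) ->
  nrm (\avg_ x (g x * k x)) ^+ 2 <= \avg_ x nrm (k x) ^+ 2.
Proof.
move=> T0 g1.
apply: (@le_trans _ _ ((\avg_ x nrm (k x)) ^+ 2)); last first.
  by apply: exp_avg_le => // x; apply: nrm_ge0.
have le_k : nrm (\avg_ x (g x * k x)) <= \avg_ x nrm (k x).
  apply: le_trans (nrm_avg _) _; apply: le_avg => x.
  by rewrite nrmM ler_piMl ?nrm_ge0.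
by rewrite ler_pXn2r// nnegrE ?(le_trans (nrm_ge0 _) le_k) ?nrm_ge0.
Qed.

Lemma sqr_nrm_avg S (k : S -> C) :
  (nrm (avg k) ^+ 2)%:C%C = \avg_ y \avg_ y' (k y * (k y')^*%C).
Proof. by rewrite -mul_conj conj_avg avgM. Qed.

(** The doubling step of van der Corput's method. *)
Lemma van_der_corput T S (g : T -> C) (W : T -> S -> C) :
    (0 < #|T|)%N -> (forall x, nrm (g x) <= 1) ->
  nrm (\avg_ x (g x * \avg_ y W x y)) ^+ 2
    <= nrm (\avg_ x \avg_ y \avg_ y' (W x y * (W x y')^*%C)).
Proof.
move=> T0 g1; apply: le_trans (avg_weight_sqr _ T0 g1) _.
under [in leRHS]eq_avg do rewrite -sqr_nrm_avg.
by rewrite -real_avg nrmR// avg_ge0// => x; rewrite sqr_ge0.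
Qed.

End ComplexAverages.

(** * Uniformity norms and linear configurations *)

Section Uniformity.
Variables (R : rcfType) (F : finFieldType).
Local Notation C := R[i].
Implicit Types (f g : F -> C) (h x y : F).

Lemma card_field_gt0 : (0 < #|F|)%N.
Proof. by apply/card_gt0P; exists 0. Qed.
Local Hint Extern 0 (is_true (0 < #|_|)%N) => exact: card_field_gt0 : core.

Definition bdd (T : Type) (f : T -> C) := forall x : T, nrm (f x) <= 1.

Lemma shear_avg (W : F -> F -> C) (phi : F -> F) :
  \avg_ x \avg_ y W x y = \avg_ x \avg_ y W (x + phi y) y.
Proof.
rewrite exchange_avg [RHS]exchange_avg; apply: eq_avg => y.
exact: (reindex_avg (h := fun x => x + phi y) _ (@addIr _ _)).
Qed.

Lemma avg_shift (K : numFieldType) (k : F -> K) x : \avg_ y k (x + y) = avg k.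
Proof. by rewrite [RHS](reindex_avg _ (@addrI _ x)). Qed.

Lemma van_der_corput_shift g (W : F -> F -> C) : bdd g ->
  nrm (\avg_ x (g x * \avg_ y W x y)) ^+ 2
    <= \avg_ h nrm (\avg_ x \avg_ y (W x y * (W x (y + h))^*%C)).
Proof.
move=> g1; apply: le_trans (van_der_corput _ _ g1) _ => //.
apply: le_trans (nrm_avg _); rewrite exchange_avg.
rewrite le_eqVlt; apply/orP; left; apply/eqP; congr nrm.
rewrite [RHS](exchange_avg (fun h x => \avg_ y (W x y * (W x (y + h))^*%C))).
rewrite exchange_avg; apply: eq_avg => x; rewrite [RHS]exchange_avg.
by apply: eq_avg => y; rewrite -(avg_shift _ y).
Qed.

Lemma avg_affine (K : numFieldType) (k : F -> K) (b c : F) : c != 0 ->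
  \avg_ y k (b + c * y) = avg k.
Proof.
move=> c0; rewrite -[RHS](avg_shift _ b).
by rewrite [RHS](reindex_avg _ (mulfI c0)).
Qed.

Definition mder h f : F -> C := fun x => f x * (f (x + h))^*%C.

Lemma bdd_mder h f : bdd f -> bdd (mder h f).
Proof. by move=> f1 x; rewrite nrmM_le1 ?nrm_conj. Qed.

(** The [2 ^ s.+1]-th power of the Gowers uniformity norm of order [s.+1]; at
    order one it is the square of the modulus of the mean, hence real, and this
    is where the recursion starts. *)
Fixpoint unif (s : nat) f : R :=
  if s is s'.+1 then \avg_ h unif s' (mder h f) else nrm (avg f) ^+ 2.

Lemma unif_ge0 s f : 0 <= unif s f.
Proof.
elim: s f => [|s IHs] f /=; first exact: sqr_ge0.
by apply: avg_ge0 => h; apply: IHs.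
Qed.

Lemma unif_le1 s f : bdd f -> unif s f <= 1.
Proof.
elim: s f => [|s IHs] f f1 /=.
  by rewrite expr_le1 ?nrm_ge0 ?nrm_avg_le1.
by apply: avg_le_cst => // h; apply: IHs; apply: bdd_mder.
Qed.

(** Linear configurations are controlled by uniformity norms: each application
    of Cauchy--Schwarz removes one of the functions [z.1] and differentiates
    [f] once, and the condition [a != sg * z.2] keeps the increment of [f]
    equidistributed.  The coefficient [sg] allows the argument of [f] to be
    [y] alone. *)
Lemma linear_control (f : F -> C) (sg a : F) (z0 : (F -> C) * F)
    (L : seq ((F -> C) * F)) :
    bdd f -> (forall z, z \in z0 :: L -> bdd z.1 /\ a != sg * z.2) ->
  nrm (\avg_ x \avg_ y (f (sg * x + a * y)
         * \prod_(z <- z0 :: L) z.1 (x + z.2 * y))) ^+ (2 ^ (size L).+1)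
    <= unif (size L) f.
Proof.
move nE : (size L) => n; elim: n f a z0 L nE => [|n IHn] f a z0 L nE f1 HL.
  move/size0nil: nE => ->; have [z1 az] := HL z0 (mem_head _ _).
  rewrite (shear_avg _ (fun y => - (z0.2 * y))) /=.
  under eq_avg => x.
    under eq_avg => y.
      rewrite big_seq1 subrK mulrDr -addrA mulrN mulrA -mulNr -mulrDl mulrC.
      rewrite [- _ + a]addrC; over.
    rewrite avgMl avg_affine; last by rewrite subr_eq0.
    over.
  rewrite avgMr nrmM exprMn ler_piMl ?sqr_ge0 // expr_le1 ?nrm_ge0 //.
  exact: nrm_avg_le1.
have [z1 az] := HL z0 (mem_head _ _).
case: L nE HL => // w0 L [nE] HL.
pose a' := a - sg * z0.2.
pose W x y := f (sg * x + a' * y) *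
  \prod_(z <- w0 :: L) z.1 (x + (z.2 - z0.2) * y).
have -> : \avg_ x \avg_ y (f (sg * x + a * y)
         * \prod_(z <- [:: z0, w0 & L]) z.1 (x + z.2 * y))
       = \avg_ x (z0.1 x * \avg_ y W x y).
  rewrite (shear_avg _ (fun y => - (z0.2 * y))) /=.
  apply: eq_avg => x; rewrite -avgMl; apply: eq_avg => y.
  rewrite big_cons subrK mulrCA; congr (_ * (f _ * _)); first by rewrite /a'; ring.
  by apply: eq_bigr => z _; congr (z.1 _); ring.
pose twist h := [seq (mder ((z.2 - z0.2) * h) z.1, z.2 - z0.2) | z <- w0 :: L].
have -> : (2 ^ n.+2 = 2 * 2 ^ n.+1)%N by rewrite expnS.
rewrite exprM.
apply: le_trans (_ : (\avg_ h nrm (\avg_ x \avg_ y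
    (mder (a' * h) f (sg * x + a' * y)
       * \prod_(z <- twist h) z.1 (x + z.2 * y)))) ^+ (2 ^ n.+1) <= _).
  rewrite lerXn2r ?nnegrE ?sqr_ge0 //; first by rewrite avg_ge0 // => h; apply: nrm_ge0.
  apply: le_trans (van_der_corput_shift _ z1) _; apply: le_avg => h.
  rewrite le_eqVlt; apply/orP; left; apply/eqP; congr nrm.
  apply: eq_avg => x; apply: eq_avg => y.
  rewrite /W rmorphM /= rmorph_prod /= mulrACA big_map -big_split /=; congr (_ * _).
    by rewrite /mder; congr (_ * (f _)^*%C); ring.
  by apply: eq_bigr => z _; rewrite /mder; congr (_ * (z.1 _)^*%C); ring.
apply: le_trans (exp_avg_le _ _ _) _ => //; first by move=> h; apply: nrm_ge0.
have a'0 : a' != 0 by rewrite subr_eq0.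
rewrite -[leRHS]/(\avg_ h unif n (mder h f)).
rewrite [leRHS](reindex_avg _ (mulfI a'0)) /=; apply: le_avg => h.
rewrite /twist map_cons; apply: IHn; first by rewrite size_map.
- exact: bdd_mder.
- rewrite -map_cons => z /mapP[w wL ->] /=.
  have [w1 aw] := HL w (mem_behead (s := _ :: _) wL); split; first exact: bdd_mder.
  by apply: contra_neq aw; rewrite /a' mulrBr => /addIr.
Qed.

End Uniformity.

(** * Translates of polynomials *)

Section PolyShift.
Variable F : fieldType.
Implicit Types p q : {poly F}.

Definition shiftp (h : F) p := p \Po ('X + h%:P).

Lemma horner_shiftp h p x : (shiftp h p).[x] = p.[x + h].
Proof. by rewrite horner_comp hornerD hornerX hornerC. Qed.

Lemma shiftp0 p : shiftp 0 p = p.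
Proof. by rewrite /shiftp addr0 comp_polyXr. Qed.

Lemma size_shiftp h p : size (shiftp h p) = size p.
Proof. by rewrite size_comp_poly2 // size_XaddC. Qed.

Lemma coef_shiftp_lead h p e : (size p <= e.+1)%N -> (shiftp h p)`_e = p`_e.
Proof.
rewrite leq_eqVlt => /orP[/eqP sp|sp]; last first.
  by rewrite !nth_default // ?size_shiftp -1?ltnS.
have := lead_coef_comp p (q := 'X + h%:P); rewrite size_XaddC lead_coefXaddC.
by rewrite expr1n mulr1 !lead_coefE -/(shiftp h p) size_shiftp sp /=; apply.
Qed.

Lemma coef_shiftp_sublead h p e : (size p <= e.+2)%N ->
  (shiftp h p)`_e = p`_e + e.+1%:R * p`_e.+1 * h.
Proof.
elim/poly_ind: p e => [|p c IHp] e sp.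
  by rewrite /shiftp comp_poly0 !coef0 mulr0 mul0r addr0.
have {}sp : (size p <= e.+1)%N.
  move: sp; rewrite size_MXaddC; case: ifP => [/andP[/eqP-> _]|_ //].
  by rewrite size_poly0.
rewrite /shiftp comp_polyD comp_polyM comp_polyX comp_polyC -/(shiftp h p).
rewrite mulrDr !coefD !coefMX !coefMC !coefC.
case: e sp => [|e] sp /=.
  by rewrite coef_shiftp_lead //; ring.
by rewrite IHp // coef_shiftp_lead // -[e.+2%:R]natr1; ring.
Qed.

End PolyShift.

(** * Polynomial configurations *)

Section Configurations.
Variables (R : rcfType) (F : finFieldType).
Local Notation C := R[i].
Local Notation system := (seq ((F -> C) * {poly F})).
Implicit Types (f : F -> C) (Q B : {poly F}) (L : system).
Local Hint Extern 0 (is_true (0 < #|_|)%N) => exact: card_field_gt0 : core.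

Definition config f Q L : C :=
  \avg_ x \avg_ y (f (x + Q.[y]) * \prod_(z <- L) z.1 (x + z.2.[y])).

Definition noncst L := [seq z <- L | (1 < size (z.2 : {poly F}))%N].

(** What accompanies the target [f] after one Cauchy--Schwarz step.  The head is
    the copy of the target itself at [y + h]; the functions with a constant
    polynomial do not depend on [y] and have been discarded. *)
Definition vdc_system (h : F) B f Q L : system :=
  (conjc \o f, shiftp h Q - B) ::
  [seq (z.1, z.2 - B) | z <- noncst L] ++
  [seq (conjc \o z.1, shiftp h z.2 - B) | z <- noncst L].

Lemma config_vdc (B : F -> {poly F}) f Q L :
    (forall z, z \in L -> bdd z.1) ->
  nrm (config f Q L) ^+ 2
    <= \avg_ h nrm (config f (Q - B h) (vdc_system h (B h) f Q L)).
Proof.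
move=> L1.
pose g x := \prod_(z <- L | ~~ (1 < size z.2)%N) z.1 (x + z.2`_0).
pose W x y := f (x + Q.[y]) * \prod_(z <- noncst L) z.1 (x + z.2.[y]).
have -> : config f Q L = \avg_ x (g x * \avg_ y W x y).
  apply: eq_avg => x; rewrite -avgMl; apply: eq_avg => y.
  rewrite /W mulrCA; congr (_ * _).
  rewrite (bigID (fun z : _ * {poly F} => 1 < size z.2)%N) /= mulrC big_filter.
  congr (_ * _); apply: eq_bigr => z; rewrite -leqNgt => /size1_polyC zc.
  by rewrite zc hornerC coefC.
have g1 : bdd g.
  move=> x; rewrite /g big_seq_cond; apply: nrm_prod_le1 => z /andP[zL _].
  exact: L1.
apply: le_trans (van_der_corput_shift _ g1) _; apply: le_avg => h.
rewrite le_eqVlt; apply/orP; left; apply/eqP; congr nrm.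
rewrite (shear_avg _ (fun y => - (B h).[y])).
apply: eq_avg => x; apply: eq_avg => y.
rewrite /W rmorphM /= rmorph_prod /= mulrACA -mulrA.
rewrite big_cons big_cat /= !big_map /= !hornerD !hornerN horner_shiftp.
congr (f _ * _); first ring.
congr (_ * _); first by congr (f _)^*%C; ring.
congr (_ * _); apply: eq_bigr => z _; rewrite !hornerD !hornerN ?horner_shiftp.
  by congr (z.1 _); ring.
by congr (z.1 _)^*%C; ring.
Qed.

End Configurations.

(** * Lexicographic descent on leading coefficients *)

(** The order is lexicographic with the highest index first: a lower weight may
    be replaced by any number when a higher one decreases. *)
Lemma lex_ind (D : nat) (P : (nat -> nat) -> Prop) :
    (forall w, (forall w' e, (e <= D)%N -> (w' e < w e)%N ->
       (forall i, (e < i <= D)%N -> (w' i <= w i)%N) -> P w') -> P w) ->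
  forall w, P w.
Proof.
move=> stepP.
have below j : forall w0 : nat -> nat,
    (forall w' e, (j <= e <= D)%N -> (w' e < w0 e)%N ->
       (forall i, (e < i <= D)%N -> (w' i <= w0 i)%N) -> P w') ->
    forall w, (forall i, (j <= i <= D)%N -> (w i <= w0 i)%N) -> P w.
  elim: j => [|j IHj] w0 Pw0 w le_w.
    apply: stepP => w' e eD lt_e le_w'.
    apply: (Pw0 w' e) => [|/=|i iD]; first by rewrite eD.
      by rewrite (leq_trans lt_e) ?le_w ?eD.
    by rewrite (leq_trans (le_w' i iD)) // le_w //; case/andP: iD.
  have [n] := ubnP (w j); elim: n w le_w => // n IHn w le_w; rewrite ltnS => wn.
  apply: (IHj w) => // w' e /andP[je eD] lt_e le_w'.
  move: je; rewrite leq_eqVlt => /orP[/eqP ej|je].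
    apply: IHn => [i /andP[ji iD]|]; last by rewrite ej (leq_trans lt_e) ?ej -?ej.
    by rewrite (leq_trans (le_w' i _)) ?le_w ?ji //; lia.
  apply: (Pw0 w' e) => [|/=|i iD]; first by rewrite je.
    by rewrite (leq_trans lt_e) ?le_w ?eD ?je.
  by rewrite (leq_trans (le_w' i iD)) // le_w //; lia.
move=> w; apply: (below D.+1 w) => // w' e; lia.
Qed.

Section LeadingCoefficients.
Variable F : finFieldType.
Implicit Types (p q b Q : {poly F}) (S : seq {poly F}).

Definition leads (e : nat) S : seq F :=
  undup [seq p`_e | p <- S & size (p : {poly F}) == e.+1].

Lemma leadsP e S c :
  reflect (exists2 p, p \in S & size p = e.+1 /\ p`_e = c) (c \in leads e S).
Proof.
rewrite mem_undup; apply: (iffP mapP) => [[p] | [p pS [sp <-]]].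
  by rewrite mem_filter => /andP[/eqP sp pS] ->; exists p.
by exists p; rewrite // mem_filter sp eqxx.
Qed.

Lemma size_leads e S : (size (leads e S) <= size S)%N.
Proof.
by rewrite (leq_trans (size_undup _)) // size_map size_filter count_size.
Qed.

Lemma exists_min_size S Q : Q \in S ->
  exists2 b, b \in S & forall p, p \in S -> (size b <= size p)%N.
Proof.
move=> QS; pose P n := has (fun p => size p == n) S.
have exP : exists n, P n by exists (size Q); apply/hasP; exists Q.
case: (ex_minnP exP) => n /hasP[b bS /eqP<-] minb; exists b => // p pS.
by apply: minb; apply/hasP; exists p.
Qed.

(** What one doubling step does to the leading coefficients of a family: above
    the degree [e] of the subtracted polynomial nothing new appears, and in
    degree [e] the leading coefficients are translated and one of them, that
    of the subtracted polynomial itself, is lost. *)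
Lemma leads_step S S' b (hb : F) (e : nat) :
    b \in S -> size b = e.+1 ->
    (forall p, p \in S -> (e.+1 <= size p)%N) ->
    (forall q, q \in S' -> exists2 p, p \in S &
       exists h, q = shiftp h p - shiftp hb b) ->
  (size (leads e S') < size (leads e S))%N /\
  (forall i, (e < i)%N -> (size (leads i S') <= size (leads i S))%N).
Proof.
move=> bS sb minS S'E.
have sB : size (shiftp hb b) = e.+1 by rewrite size_shiftp.
split=> [|i ei].
  have bl : b`_e \in leads e S by apply/leadsP; exists b.
  apply: (@leq_ltn_trans (size (rem b`_e (leads e S)))); last first.
    by rewrite size_rem // ltn_predL lt0n size_eq0; apply: contraTneq bl => ->.
  rewrite -[leqRHS](size_map (fun c => c - b`_e)); apply: uniq_leq_size; first exact: undup_uniq.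
  move=> c /leadsP[q /S'E[p pS [h ->]] [sq <-]].
  have sp : size p = e.+1.
    apply/eqP; rewrite eqn_leq minS // andbT leqNgt; apply/negP => ep.
    by move: sq; rewrite size_polyDl ?size_polyN ?size_shiftp ?sb // => sp; rewrite sp ltnn in ep.
  rewrite coefB !coef_shiftp_lead ?sp ?sb //.
  apply: map_f; rewrite mem_rem_uniq ?undup_uniq // inE.
  apply/andP; split; last by apply/leadsP; exists p.
  apply: contra_eq_neq sq => pb; rewrite ltn_eqF // ltnS.
  apply/leq_sizeP => j; rewrite leq_eqVlt => /orP[/eqP<-|ej].
    by rewrite coefB !coef_shiftp_lead ?sp ?sb // pb subrr.
  by rewrite coefB !nth_default ?subrr // size_shiftp ?sp ?sb.
apply: uniq_leq_size; first exact: undup_uniq.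
move=> c /leadsP[q /S'E[p pS [h ->]] [sq <-]].
have ep : (e.+1 < size p)%N.
  rewrite ltnNge; apply/negP => pe.
  have : (size (shiftp h p - shiftp hb b)%R <= e.+1)%N.
    by rewrite (leq_trans (size_polyD _ _)) // size_polyN !size_shiftp sb geq_max pe leqnn.
  by rewrite sq; lia.
move: sq; rewrite size_polyDl ?size_polyN ?size_shiftp ?sb // => sp.
apply/leadsP; exists p => //; split=> //.
by rewrite coefB coef_shiftp_lead ?sp // [(shiftp hb b)`__]nth_default ?subr0 ?sB.
Qed.

Lemma size_sub_shift Q d h : d.+1%:R != 0 :> F -> h != 0 -> size Q = d.+2 ->
  size (Q - shiftp h Q) = d.+1.
Proof.
move=> dF h0 sQ; apply/eqP; rewrite eqn_leq; apply/andP; split.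
  apply/leq_sizeP => j; rewrite leq_eqVlt => /orP[/eqP<-|dj].
    by rewrite coefB coef_shiftp_lead ?sQ // subrr.
  by rewrite coefB !nth_default ?subrr ?size_shiftp ?sQ.
rewrite ltnNge; apply/negP => /leq_sizeP/(_ d (leqnn _))/eqP.
rewrite coefB coef_shiftp_sublead ?sQ // opprD addNKr oppr_eq0 !mulf_eq0.
rewrite (negPf dF) (negPf h0) orbF /=.
by rewrite -[d.+1]/(d.+2.-1) -sQ -lead_coefE lead_coef_eq0 -size_poly_eq0 sQ.
Qed.

(** The polynomial [B h] to subtract is chosen of minimal degree, and so that
    the target [Q] keeps the maximal degree.  When every polynomial has the
    degree and the leading coefficient of [Q], all degrees drop, and it is the
    translate of [Q] itself that must be subtracted. *)
Lemma base_choice S Q (d : nat) :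
    (0 < d)%N -> d.+1%:R != 0 :> F -> Q \in S -> size Q = d.+2 ->
    (forall p, p \in S -> (1 < size p <= d.+2)%N) ->
  exists (e d' : nat) (b : {poly F}) (s : F -> F),
    [/\ [/\ (0 < e <= d.+1)%N, (0 < d' <= d.+1)%N & b \in S],
        size b = e.+1,
        forall p, p \in S -> (e.+1 <= size p)%N,
        forall h, h != 0 -> size (Q - shiftp (s h) b) = d'.+1
      & forall h h' p, p \in S ->
          (size (shiftp h' p - shiftp (s h) b)%R <= d'.+1)%N].
Proof.
move=> d0 dF QS sQ sS; have [b bS minb] := exists_min_size QS.
have [e sb] : exists e, size b = e.+1.
  by exists (size b).-1; case/andP: (sS b bS); lia.
have bnd h' p s b' : (size p <= d.+2)%N -> (size b' <= d.+2)%N ->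
    (size (shiftp h' p - shiftp s b')%R <= d.+2)%N.
  move=> sp sb'; rewrite (leq_trans (size_polyD _ _)) // size_polyN.
  by rewrite !size_shiftp geq_max sp sb'.
have e0 : (0 < e)%N by case/andP: (sS b bS); lia.
have ed : (e <= d.+1)%N by case/andP: (sS b bS); lia.
have topsize p s b' : (size p <= d.+2)%N -> (size b' <= d.+2)%N ->
    p`_d.+1 != b'`_d.+1 -> size (p - shiftp s b') = d.+2.
  move=> sp sb' pb; apply/eqP; rewrite eqn_leq.
  have := bnd 0 p s b' sp sb'; rewrite shiftp0 => -> /=.
  rewrite ltnNge; apply: contra pb => /leq_sizeP/(_ d.+1 (leqnn _))/eqP.
  by rewrite coefB subr_eq0 coef_shiftp_lead.
have [/hasP[b' b'S /andP[/eqP sb' Qb']]|] := boolP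
    (has (fun b' => (size b' == e.+1) && (Q`_d.+1 != b'`_d.+1)) S).
  exists e, d.+1, b', (fun=> 0); split=> //.
  - by rewrite e0 ed ltnS leqnn.
  - by move=> p /minb; rewrite sb.
  - by move=> h _; rewrite topsize ?sQ // sb'.
  - by move=> h h' p pS; rewrite bnd ?sb' //; case/andP: (sS p pS).
move=> /hasPn allS.
have topQ p : p \in S -> size p = d.+2 /\ p`_d.+1 = Q`_d.+1.
  have ed1 : e = d.+1.
    apply/eqP; rewrite eqn_leq ed /= leqNgt; apply/negP => lt_ed.
    have := allS b bS; rewrite sb eqxx /= negbK [b`__]nth_default ?sb //.
    by rewrite -[d.+1]/(d.+2.-1) -sQ -lead_coefE lead_coef_eq0 -size_poly_eq0 sQ.
  move=> pS; have sp : size p = d.+2.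
    apply/eqP; rewrite eqn_leq; case/andP: (sS p pS) => _ ->.
    by rewrite -ed1 -sb minb.
  split=> //; have := allS p pS; rewrite sp ed1 eqxx /= negbK.
  by move/eqP.
exists d.+1, d, Q, id; split=> //.
- by rewrite !ltnS leqnn d0 leqnSn.
- by move=> p /topQ[->].
- by move=> h h0; apply: size_sub_shift.
move=> h h' p /topQ[sp pQ]; apply/leq_sizeP => j.
rewrite leq_eqVlt => /orP[/eqP<-|dj].
  by rewrite coefB !coef_shiftp_lead ?sQ ?sp // pQ subrr.
by rewrite coefB !nth_default ?subrr ?size_shiftp ?sQ ?sp.
Qed.

(** The coefficient below the leading one is an injective function of the
    translation, so it takes the value required for a constant difference at
    most once. *)
Lemma card_bad_shift Q p (D : nat) :
    (forall i, (0 < i <= D)%N -> i%:R != 0 :> F) ->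
    (size p <= D.+1)%N -> (1 < size (Q - p)%R)%N ->
  (#|[set h | size (Q - shiftp h p)%R <= 1]%N| <= 1)%N.
Proof.
move=> DF sp Qp; apply/card_le1P => h1 h1bad h2; rewrite !inE.
have {}h1bad : (size (Q - shiftp h1 p)%R <= 1)%N by move: h1bad; rewrite inE.
apply/idP/eqP => [h2bad|-> //].
have [sp2|sp2] := leqP (size p) 2.
  suff : (size (Q - p)%R <= 1)%N by lia.
  have -> : Q - p = (Q - shiftp h1 p) + (shiftp h1 p - p) by rewrite addrA subrK.
  rewrite (leq_trans (size_polyD _ _)) // geq_max h1bad.
  apply/leq_sizeP => j; rewrite leq_eqVlt => /orP[/eqP<-|dj].
    by rewrite coefB coef_shiftp_lead // subrr.
  by rewrite coefB !nth_default ?subrr ?size_shiftp // (leq_trans sp2).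
have [e sp3 eD] : exists2 e, size p = e.+3 & (e.+2 <= D)%N.
  by exists (size p - 3)%N; lia.
have coefe h : (size (Q - shiftp h p)%R <= 1)%N ->
    Q`_e.+1 = p`_e.+1 + e.+2%:R * p`_e.+2 * h.
  move=> /leq_sizeP/(_ e.+1 isT)/eqP; rewrite coefB subr_eq0 => /eqP->.
  by rewrite coef_shiftp_sublead // sp3.
have := coefe _ h2bad; rewrite (coefe _ h1bad) => /addrI/mulfI->//.
rewrite mulf_neq0 ?DF //.
by rewrite -[e.+2]/(e.+3.-1) -sp3 -lead_coefE lead_coef_eq0 -size_poly_eq0 sp3.
Qed.

Lemma card_bigcup_le (I : eqType) (r : seq I) (A : I -> {set F}) :
  (forall i, i \in r -> (#|A i| <= 1)%N) ->
  (#|\bigcup_(i <- r) A i| <= size r)%N.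
Proof.
elim: r => [|i r IHr] A1; first by rewrite big_nil cards0.
rewrite big_cons (leq_trans (leq_card_setU _ _)) //.
rewrite -[size _]/(1 + size r)%N leq_add ?A1 ?mem_head //.
by apply: IHr => j jr; rewrite A1 // in_cons jr orbT.
Qed.

Lemma mem_bigcup_seq (I : eqType) (r : seq I) (A : I -> {set F}) i h :
  i \in r -> h \in A i -> h \in \bigcup_(j <- r) A j.
Proof. by move=> ir hA; rewrite (big_rem i ir) /= inE hA. Qed.

End LeadingCoefficients.

(** * Control by uniformity norms *)

Section PET.
Variable R : rcfType.
Local Notation C := R[i].
Local Notation system F := (seq ((F -> C) * {poly F})).
Local Hint Extern 0 (is_true (0 < #|_|)%N) => exact: card_field_gt0 : core.

Definition char_gt (D : nat) (F : finFieldType) :=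
  forall i, (0 < i <= D)%N -> i%:R != 0 :> F.

Lemma nrm_config_le1 (F : finFieldType) (f : F -> C) (Q : {poly F}) (L : system F) :
  bdd f -> (forall z, z \in L -> bdd z.1) -> nrm (config f Q L) <= 1.
Proof.
move=> f1 L1; apply: nrm_avg_le1 => // x; apply: nrm_avg_le1 => // y.
rewrite nrmM_le1 // big_seq; apply: nrm_prod_le1 => z zL; exact: L1.
Qed.

Lemma avg_exceptional (F : finFieldType) (a : F -> R) (A : {set F}) (c : R) :
    0 <= c -> (forall h, a h <= 1) -> (forall h, h \notin A -> a h <= c) ->
  avg a <= c + #|A|%:R / #|F|%:R.
Proof.
move=> c0 a1 ac; rewrite -[c in leRHS](avg_cst c (card_field_gt0 F)).
have -> : #|A|%:R / #|F|%:R = \avg_ h (h \in A)%:R :> R.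
  by rewrite /avg -natr_sum -sum1_card big_mkcond.
rewrite -avgD; apply: le_avg => h; case: (boolP (h \in A)) => [_|hA].
  by rewrite (le_trans (a1 h)) // lerDr.
by rewrite addr0 ac.
Qed.

Lemma unif_translate (F : finFieldType) s (f : F -> C) c :
  unif s (fun x => f (x + c)) = unif s f.
Proof.
elim: s f => [|s IHs] f /=.
  by rewrite [in RHS](reindex_avg _ (@addIr _ c)).
apply: eq_avg => h; rewrite -[RHS]IHs; congr unif.
by apply/funext => x; rewrite /mder addrAC.
Qed.

(** The constants [N], [K] and [s] do not depend on the field.  The sum over all
    orders below [s] makes the bound weaker when [s] grows, so that finitely
    many such bounds can be merged. *)
Definition pet_bound (D : nat) (w : nat -> nat) (n N K s : nat) : Prop :=
  forall (F : finFieldType) (f : F -> C) (Q : {poly F}) (L : system F) (d : nat),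
    char_gt D F -> bdd f -> (forall z, z \in L -> bdd z.1) ->
    (0 < d <= D)%N -> size Q = d.+1 ->
    (forall z, z \in L -> (size z.2 <= d.+1)%N) ->
    (forall z, z \in L -> (1 < size (Q - z.2)%R)%N) ->
    (size L <= n)%N ->
    (forall i, (0 < i <= D)%N ->
      (size (leads i (Q :: [seq z.2 | z <- L])) <= w i)%N) ->
  nrm (config f Q L) ^+ N <= K%:R * (\sum_(i < s) unif i f + #|F|%:R^-1).

Lemma sum_unif_le (F : finFieldType) (f : F -> C) s s' : (s <= s')%N ->
  \sum_(i < s) unif i f <= \sum_(i < s') unif i f.
Proof.
move=> ss'; rewrite -!(big_mkord xpredT (fun i => unif i f)).
rewrite (big_cat_nat (leq0n s) ss') /= lerDl.
by apply: sumr_ge0 => i _; apply: unif_ge0.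
Qed.

(** The base of the induction on degrees, where the second copy of the target
    has the same argument as the first up to a constant, and differentiates it
    instead of joining the other functions. *)
Lemma config_linear (F : finFieldType) (f : F -> C) (Q : {poly F}) (L : system F) n :
    bdd f -> (forall z, z \in L -> bdd z.1) -> size Q = 2 ->
    (forall z, z \in L -> (size z.2 <= 2)%N) ->
    (forall z, z \in L -> (1 < size (Q - z.2)%R)%N) ->
    (size L <= n)%N ->
  nrm (config f Q L) ^+ (2 ^ n.+1) <= \sum_(i < n.+1) unif i f.
Proof.
move=> f1 L1 sQ sL QL Ln.
have := nrm_config_le1 Q f1 L1.
have lin (p : {poly F}) y : (size p <= 2)%N -> p.[y] = p`_1 * y + p`_0.
  move=> sp; rewrite (horner_coef_wide _ sp) !big_ord_recl big_ord0 /=.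
  by rewrite expr0 expr1 mulr1 addr0 addrC.
pose f' x := f (x + Q`_0).
pose L' := [seq ((fun x => z.1 (x + (z.2 : {poly F})`_0)), (z.2 : {poly F})`_1) | z <- L].
pose z0 : (F -> C) * F := ((fun=> 1), 0).
have -> : config f Q L = \avg_ x \avg_ y (f' (1 * x + Q`_1 * y)
     * \prod_(z <- z0 :: L') z.1 (x + z.2 * y)).
  apply: eq_avg => x; apply: eq_avg => y; rewrite big_cons mul1r big_map mul1r.
  rewrite /f' lin ?sQ // addrA; congr (_ * _); rewrite !big_seq.
  by apply: eq_bigr => z zL; rewrite /= lin ?sL // addrA.
have Q1 : Q`_1 != 0.
  have : lead_coef Q != 0 by rewrite lead_coef_eq0 -size_poly_eq0 sQ.
  by rewrite lead_coefE sQ.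
have ctrl : nrm (\avg_ x \avg_ y (f' (1 * x + Q`_1 * y)
     * \prod_(z <- z0 :: L') z.1 (x + z.2 * y))) ^+ (2 ^ (size L).+1)
   <= unif (size L) f.
  rewrite -(unif_translate (size L) f Q`_0) -(size_map _ L : size L' = _).
  apply: linear_control => [x|z]; first exact: f1.
  rewrite in_cons => /orP[/eqP->|/mapP[u uL ->]] /=.
    by split; [move=> x; rewrite nrm1|rewrite mul1r].
  split; first by move=> x; apply: L1.
  rewrite mul1r; apply: contraTneq (QL u uL) => Qu; rewrite -leqNgt.
  apply/leq_sizeP => j; rewrite leq_eqVlt => /orP[/eqP<-|dj].
    by rewrite coefB Qu subrr.
  by rewrite coefB !nth_default ?subrr // ?sQ // (leq_trans (sL u uL)).
set X := nrm _ in ctrl *; have X0 : 0 <= X := nrm_ge0 _; move=> X1.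
apply: le_trans (_ : X ^+ (2 ^ (size L).+1) <= _).
  by rewrite ler_wiXn2l // leq_exp2l.
apply: le_trans ctrl _; rewrite (bigD1 (Ordinal (_ : size L < n.+1)%N)) //=.
by rewrite lerDl sumr_ge0 // => i _; apply: unif_ge0.
Qed.

End PET.

Section PETInduction.
Variable R : rcfType.
Local Notation C := R[i].
Local Notation system F := (seq ((F -> C) * {poly F})).
Local Hint Extern 0 (is_true (0 < #|_|)%N) => exact: card_field_gt0 : core.

Lemma pet_bound_weaken D w n N K s N' K' s' :
    (N <= N')%N -> (K <= K')%N -> (s <= s')%N ->
  pet_bound R D w n N K s -> pet_bound R D w n N' K' s'.
Proof.
move=> NN' KK' ss' H F f Q L d cF f1 L1 dD sQ sL QL Ln Lw.
apply: (@le_trans _ _ (nrm (config f Q L) ^+ N)).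
  by rewrite ler_wiXn2l ?nrm_ge0 ?nrm_config_le1.
apply: le_trans (H F f Q L d cF f1 L1 dD sQ sL QL Ln Lw) _.
have U0 k : 0 <= \sum_(i < k) unif i f.
  by apply: sumr_ge0 => i _; apply: unif_ge0.
apply: ler_pM; rewrite ?ler0n ?addr_ge0 ?invr_ge0 ?ler0n ?ler_nat //.
by rewrite lerD2r sum_unif_le.
Qed.

(** One step replaces the system by twice as many functions, but lowers the
    number of leading coefficients in the minimal degree and keeps it in higher
    degrees.  For all but a bounded number of increments [h] the new system
    satisfies the hypotheses again, and the exceptional ones contribute to the
    term [#|F|^-1]. *)
Lemma pet (D : nat) (w : nat -> nat) :
  forall n, exists N K s, pet_bound R D w n N K s.
Proof.
elim/(@lex_ind D): w => w IHw n.
(* The weights after subtracting a polynomial of degree [e]: nothing is known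
   below [e] beyond the number of polynomials. *)
pose w' e i := if (i < e)%N then (2 * n + 2)%N
               else if i == e then (w e).-1 else w i.
have [t tP] : {t : nat -> nat * nat * nat & forall e, (e <= D)%N -> (0 < w e)%N ->
    pet_bound R D (w' e) (2 * n).+1 (t e).1.1 (t e).1.2 (t e).2}.
  pose ok e (u : nat * nat * nat) := (e <= D)%N -> (0 < w e)%N ->
    pet_bound R D (w' e) (2 * n).+1 u.1.1 u.1.2 u.2.
  apply: (@choice _ _ ok) => e; have [/andP[eD we]|] := boolP ((e <= D) && (0 < w e))%N.
    have [|i iD|N [K [s H]]] := IHw (w' e) e eD _ _ (2 * n).+1.
    - by rewrite /w' ltnn eqxx ltn_predL.
    - by rewrite /w'; case: ltngtP iD => //; lia.
    - by exists (N, K, s).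
  by move=> /negP eD; exists (0, 0, 0)%N => eD' we; case: eD; rewrite eD'.
pose N := (\max_(e < D.+1) (t e).1.1)%N.
pose K := (\max_(e < D.+1) (t e).1.2)%N.
pose s := (\max_(e < D.+1) (t e).2)%N.
have {}tP e : (e <= D)%N -> (0 < w e)%N -> pet_bound R D (w' e) (2 * n).+1 N K s.
  move=> eD we; have := tP e eD we.
  have ei : (e < D.+1)%N by [].
  by apply: pet_bound_weaken;
    [exact: (leq_bigmax (Ordinal ei))|exact: (leq_bigmax (Ordinal ei))
    |exact: (leq_bigmax (Ordinal ei))].
exists (2 * N + 2 ^ n.+1)%N, (K + n.+1)%N, (s + n.+1)%N.
move=> F f Q L d cF f1 L1 dD sQ sL QL Ln Lw.
have X1 := nrm_config_le1 Q f1 L1; have X0 := nrm_ge0 (config f Q L).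
have U0 k : 0 <= \sum_(i < k) unif i f.
  by apply: sumr_ge0 => i _; apply: unif_ge0.
have F0 : 0 <= #|F|%:R^-1 :> R by rewrite invr_ge0 ler0n.
have [d1|d2] := leqP d 1.
  have d11 : d = 1%N by lia.
  subst d.
  apply: (@le_trans _ _ (nrm (config f Q L) ^+ (2 ^ n.+1))).
    by rewrite ler_wiXn2l // leq_addl.
  apply: le_trans (config_linear f1 L1 sQ sL QL Ln) _.
  apply: (@le_trans _ _ (\sum_(i < s + n.+1) unif i f + #|F|%:R^-1)).
    by rewrite ler_wpDr // sum_unif_le // leq_addl.
  by rewrite ler_peMl ?addr_ge0 // ler1n addnS.
have [d' ed] : exists d', d = d'.+2 by exists (d - 2)%N; lia.
subst d; have dF : d'.+2%:R != 0 :> F by apply: cF; lia.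
pose S := Q :: [seq z.2 | z <- noncst L].
have SP p : p \in S -> (1 < size p <= d'.+3)%N.
  rewrite in_cons => /orP[/eqP->|/mapP[z]]; first by rewrite sQ !ltnS leqnn.
  by rewrite mem_filter => /andP[z1 zL ->]; rewrite z1 sL.
have QS : Q \in S by apply: mem_head.
have zS z : z \in noncst L -> z.2 \in S.
  by move=> zL; rewrite in_cons map_f ?orbT.
have [e [d1 [b [tr [[e_int d1_int bS] sb minS sizeQ sizeS]]]]] :=
  base_choice (isT : 0 < d'.+1)%N dF QS sQ SP.
have eD : (e <= D)%N by lia.
have leadsS i : (0 < i <= D)%N -> (size (leads i S) <= w i)%N.
  move=> iD; apply: leq_trans (Lw i iD); apply: uniq_leq_size; first exact: undup_uniq.
  move=> c /leadsP[p pS pc]; apply/leadsP; exists p => //.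
  move: pS; rewrite !in_cons => /orP[->//|/mapP[z]]; rewrite mem_filter => /andP[_ zL] ->.
  by rewrite map_f ?orbT.
have we : (0 < w e)%N.
  apply: leq_trans (leadsS e _); last by lia.
  have bl : b`_e \in leads e S by apply/leadsP; exists b.
  by rewrite lt0n size_eq0; apply: contraTneq bl => ->.
have noncst_le : (size (noncst L) <= n)%N.
  by rewrite (leq_trans _ Ln) // size_filter count_size.
pose B h := shiftp (tr h) b.
pose new h := vdc_system h (B h) f Q L.
have newE h z : z \in new h -> bdd z.1 /\
    exists2 p, p \in S & exists h', z.2 = shiftp h' p - B h.
  rewrite in_cons mem_cat => /orP[/eqP->|/orP[]/mapP[u uL ->]] /=.
  - by split; [move=> x; rewrite nrm_conj|exists Q => //; exists h].
  - split; first by apply: L1; move: uL; rewrite mem_filter => /andP[].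
    by exists u.2; [exact: zS|exists 0; rewrite shiftp0].
  - split; last by exists u.2; [exact: zS|exists h].
    by move=> x; rewrite nrm_conj L1 //; move: uL; rewrite mem_filter => /andP[].
(* The increments for which some difference with the target becomes constant. *)
pose A : {set F} := 0 |: \bigcup_(z <- noncst L)
   [set h | size (Q - shiftp h z.2)%R <= 1]%N.
have cardA : (#|A| <= n.+1)%N.
  rewrite cardsU1 -(addn1 n) addnC leq_add ?leq_b1 //.
  apply: leq_trans noncst_le; apply: card_bigcup_le => z; rewrite mem_filter => /andP[_ zL].
  apply: (card_bad_shift cF); last exact: QL.
  by rewrite (leq_trans (sL z zL)) //; lia.
have good h : h \notin A ->
    nrm (config f (Q - B h) (new h)) ^+ N
      <= K%:R * (\sum_(i < s) unif i f + #|F|%:R^-1).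
  rewrite in_setU1 negb_or => /andP[h0 hA].
  have hz z : z \in noncst L -> (1 < size (Q - shiftp h z.2)%R)%N.
    move=> zL; rewrite ltnNge; apply: contra hA => bad.
    by apply: mem_bigcup_seq zL _; rewrite inE.
  apply: (tP e eD we F f (Q - B h) (new h) d1) => //.
  - by move=> z /newE[].
  - by lia.
  - by rewrite sizeQ.
  - by move=> z /newE[_ [p pS [h' ->]]]; apply: sizeS.
  - move=> z; rewrite in_cons mem_cat => /orP[/eqP->|/orP[]/mapP[u uL ->]] /=.
    + by rewrite opprB addrA subrK (size_sub_shift dF).
    + rewrite opprB addrA subrK QL //.
      by move: uL; rewrite mem_filter => /andP[].
    + by rewrite opprB addrA subrK hz.
  - rewrite /= size_cat !size_map ltnS addnn -mul2n leq_mul2l /=.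
    exact: noncst_le.
  - move=> i iD.
    have [] := leads_step (S' := Q - B h :: [seq z.2 | z <- new h])
       (hb := tr h) bS sb minS.
      move=> q; rewrite in_cons => /orP[/eqP->|/mapP[z /newE[_ ?] ->]//].
      by exists Q => //; exists 0; rewrite shiftp0.
    rewrite /w' => lt_e le_e; case: ltngtP => [ie|/le_e le_i|->].
    + apply: leq_trans (size_leads _ _) _.
      rewrite /= size_map size_cat !size_map.
      by rewrite addn2 !ltnS addnn -mul2n leq_mul2l noncst_le.
    + by rewrite (leq_trans le_i) ?leadsS.
    + by rewrite -ltnS prednK // (leq_trans lt_e) // leadsS //; lia.
have Y1 h : nrm (config f (Q - B h) (new h)) <= 1.
  by apply: nrm_config_le1 => // z /newE[].
apply: (@le_trans _ _ ((nrm (config f Q L) ^+ 2) ^+ N)).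
  by rewrite -exprM ler_wiXn2l // leq_addr.
apply: (@le_trans _ _ ((\avg_ h nrm (config f (Q - B h) (new h))) ^+ N)).
  rewrite lerXn2r ?nnegrE ?sqr_ge0 ?config_vdc //.
  by apply: avg_ge0 => h; apply: nrm_ge0.
apply: le_trans (exp_avg_le _ _ _) _ => //; first by move=> h; apply: nrm_ge0.
apply: le_trans (avg_exceptional _ _ good) _.
- by rewrite mulr_ge0 ?ler0n ?addr_ge0.
- by move=> h; rewrite exprn_ile1 ?nrm_ge0.
rewrite natrD mulrDl lerD //.
  by rewrite ler_wpM2l ?ler0n // lerD2r sum_unif_le // leq_addr.
by apply: ler_pM; rewrite ?ler0n ?ler_nat // ler_wpDl.
Qed.

End PETInduction.

(** * Additive characters *)

Section Characters.
Variables (R : rcfType) (F : finFieldType).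
Local Notation C := R[i].
Implicit Types (f g : F -> C).
Local Hint Extern 0 (is_true (0 < #|_|)%N) => exact: card_field_gt0 : core.

Definition additive_char (e : F -> C) :=
  [/\ forall a b, e (a + b) = e a * e b, forall a, nrm (e a) = 1 & avg e = 0].

Variable e : F -> C.
Hypothesis e_char : additive_char e.

Lemma char0 : e 0 = 1.
Proof.
case: e_char => eD e1 _; have : e 0 * e 0 = e 0 * 1 by rewrite -eD addr0 mulr1.
apply: mulfI; apply/eqP => e0; have := e1 0; rewrite e0 nrm0 => /eqP.
by rewrite eq_sym oner_eq0.
Qed.

Lemma charN a : e (- a) = (e a)^*%C.
Proof.
case: e_char => eD e1 _.
have ea : e a != 0.
  by apply/eqP => e0; have := e1 a; rewrite e0 nrm0 => /eqP; rewrite eq_sym oner_eq0.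
apply: (mulfI ea); rewrite -eD subrr char0 mul_conj e1 expr1n.
by [].
Qed.

Lemma avg_char a : a != 0 -> \avg_ x e (a * x) = 0.
Proof.
case: e_char => _ _ <- a0; rewrite -(avg_affine e 0 a0).
by apply: eq_avg => x; rewrite add0r.
Qed.

Definition fourier f (a : F) : C := \avg_ x (f x * e (a * x)).

Lemma parseval f : \sum_a nrm (fourier f a) ^+ 2 = \avg_ x nrm (f x) ^+ 2.
Proof.
case: (e_char) => eD e1 _; apply: complexI.
rewrite rmorph_sum real_avg /=.
under eq_bigr do rewrite sqr_nrm_avg.
under [RHS]eq_avg do rewrite -mul_conj.
rewrite -avg_sum; apply: eq_avg => x; rewrite -avg_sum /avg.
transitivity (\sum_y (f x * (f y)^*%C * (y == x)%:R)).
  rewrite mulr_suml; apply: eq_bigr => y _.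
  have -> : \sum_a f x * e (a * x) * (f y * e (a * y))^*%C
            = f x * (f y)^*%C * \sum_a e ((x - y) * a).
    rewrite mulr_sumr; apply: eq_bigr => a _; rewrite rmorphM /= mulrACA; congr (_ * _).
    by rewrite -charN -eD; congr e; ring.
  rewrite -[LHS]mulrA; congr (_ * _); rewrite -[LHS]/(\avg_ a e ((x - y) * a)).
  case: (eqVneq y x) => [->|xy]; last by rewrite avg_char // subr_eq0 eq_sym.
  by under eq_avg do rewrite subrr mul0r char0; rewrite avg_cst.
rewrite (bigD1 x) //= eqxx mulr1 big1 ?addr0 // => y /negPf->.
by rewrite mulr0.
Qed.

(** The [U^2] norm is the [l^4] norm of the Fourier transform. *)
Lemma unif1_fourier f : unif 1 f = \sum_a nrm (fourier f a) ^+ 4.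
Proof.
case: (e_char) => eD e1 _.
rewrite /= -(parseval (fun h => avg (mder h f))) (reindex_inj (@oppr_inj F)).
apply: eq_bigr => a _; rewrite -[4%N]/(2 * 2)%N exprM; congr (_ ^+ 2).
rewrite -[RHS]ger0_norm ?sqr_ge0 // -[LHS]ger0_norm ?nrm_ge0 //; congr `|_|.
rewrite -[RHS]nrmR ?sqr_ge0 // -mul_conj; congr nrm.
rewrite /fourier conj_avg avgM /mder.
transitivity (\avg_ h \avg_ x (f x * (f (x + h))^*%C * e (- a * h))).
  by apply: eq_avg => h; rewrite avgMr.
rewrite exchange_avg; apply: eq_avg => x.
rewrite -[RHS](avg_shift _ x); apply: eq_avg => h.
rewrite rmorphM /= -charN mulrACA; congr (_ * _).
by rewrite -eD; congr e; ring.
Qed.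

Lemma unif1_le_fourier f : bdd f ->
  exists a, unif 1 f <= nrm (fourier f a) ^+ 2.
Proof.
move=> f1; exists [arg max_(a > 0) nrm (fourier f a)]%O.
case: arg_maxP => // a _ amax; rewrite unif1_fourier.
apply: (@le_trans _ _ (\sum_b nrm (fourier f a) ^+ 2 * nrm (fourier f b) ^+ 2)).
  apply: ler_sum => b _; rewrite -[4%N]/(2 + 2)%N exprD ler_wpM2r ?sqr_ge0 //.
  by rewrite lerXn2r ?nnegrE ?nrm_ge0 //; apply: amax.
rewrite -mulr_sumr parseval ler_piMr ?sqr_ge0 //.
by apply: avg_le_cst => // x; rewrite expr_le1 ?nrm_ge0.
Qed.

End Characters.

(** * Cubes and the box Cauchy--Schwarz inequality *)

Section Cubes.
Variables (R : rcfType) (F : finFieldType).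
Local Notation C := R[i].
Implicit Types (f g : F -> C) (x y : F).
Local Hint Extern 0 (is_true (0 < #|_|)%N) => exact: card_field_gt0 : core.

Fixpoint cube (r : nat) : finType :=
  if r is r'.+1 then (F * cube r')%type else unit.

Lemma card_cube_gt0 r : (0 < #|cube r|)%N.
Proof.
elim: r => [|r IHr]; first by rewrite card_unit.
by rewrite card_prod muln_gt0 IHr card_field_gt0.
Qed.

Fixpoint csum r : cube r -> F :=
  if r is r'.+1 then fun h => h.1 + csum h.2 else fun=> 0.

Fixpoint mderc r : cube r -> (F -> C) -> F -> C :=
  if r is r'.+1 then fun h f => mderc h.2 (mder h.1 f) else fun _ f => f.

(** The product of [a] and its conjugates over the vertices of the box spanned
    by [h] and [h']. *)
Fixpoint box r : (cube r -> C) -> cube r -> cube r -> C :=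
  if r is r'.+1 then fun a h h' =>
    box (fun k => a (h.1, k) * (a (h'.1, k))^*%C) h.2 h'.2
  else fun a _ _ => a tt.

(** Products of bounded functions, each of them independent of some coordinate:
    these are the factors that the box Cauchy--Schwarz inequality discards. *)
Fixpoint degenerate r : (cube r -> C) -> Prop :=
  if r is r'.+1 then fun B =>
    exists (b0 : cube r' -> C) (B' : F -> cube r' -> C),
      [/\ bdd b0, forall u, degenerate (B' u)
        & forall u h, B (u, h) = b0 h * B' u h]
  else fun B => B tt = 1.

Lemma degenerateM r (B1 B2 : cube r -> C) :
  degenerate B1 -> degenerate B2 -> degenerate (fun h => B1 h * B2 h).
Proof.
elim: r B1 B2 => [|r IHr] B1 B2 /=; first by move=> -> ->; rewrite mulr1.
move=> [b1 [B1' [b1b dB1 EB1]]] [b2 [B2' [b2b dB2 EB2]]].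
exists (fun h => b1 h * b2 h), (fun u h => B1' u h * B2' u h); split.
- by move=> h; apply: nrmM_le1.
- by move=> u; apply: IHr.
- by move=> u h; rewrite EB1 EB2 mulrACA.
Qed.

Lemma degenerate_conj r (B : cube r -> C) :
  degenerate B -> degenerate (fun h => (B h)^*%C).
Proof.
elim: r B => [|r IHr] B /=; first by move=> ->; rewrite conjc1.
move=> [b [B' [bb dB EB]]].
exists (fun h => (b h)^*%C), (fun u h => (B' u h)^*%C); split.
- by move=> h; rewrite nrm_conj.
- by move=> u; apply: IHr.
- by move=> u h; rewrite EB rmorphM.
Qed.

Lemma boxM r (a b : cube r -> C) h h' :
  box (fun k => a k * b k) h h' = box a h h' * box b h h'.
Proof.
elim: r a b h h' => //= r IHr a b h h'; rewrite -IHr; congr (box _ _ _).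
by apply/funext => k; rewrite rmorphM mulrACA.
Qed.

Lemma box_conj r (a : cube r -> C) h h' :
  box (fun k => (a k)^*%C) h h' = (box a h h')^*%C.
Proof.
elim: r a h h' => //= r IHr a h h'; rewrite -IHr; congr (box _ _ _).
by apply/funext => k; rewrite rmorphM.
Qed.

Lemma bdd_box r (a : cube r -> C) h h' : bdd a -> nrm (box a h h') <= 1.
Proof.
elim: r a h h' => [|r IHr] a h h' a1 /=; first exact: a1.
by apply: IHr => k; rewrite nrmM_le1 ?nrm_conj.
Qed.

(** All vertices other than [h] itself use a coordinate of [h'], so in a box
    with [h'] fixed they contribute degenerate functions of [h]. *)
Lemma box_split r (a : cube r -> C) h' : bdd a ->
  exists2 B, degenerate B & forall h, box a h h' = a h * B h.
Proof.
elim: r a h' => [|r IHr] a h' a1 /=.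
  by exists (fun=> 1) => // -[]; rewrite mulr1.
have au u : bdd (fun k => a (u, k)) by move=> k; apply: a1.
have [B HB] : {B : F -> cube r -> C & forall u, degenerate (B u) /\
    forall h, box (fun k => a (u, k)) h h'.2 = a (u, h) * B u h}.
  pose ok u (b : cube r -> C) := degenerate b /\
    forall h, box (fun k => a (u, k)) h h'.2 = a (u, h) * b h.
  apply: (@choice _ _ ok) => u.
  by have [b bd bE] := IHr _ h'.2 (au u); exists b.
pose b0 k := (box (fun k => a (h'.1, k)) k h'.2)^*%C.
exists (fun h => b0 h.2 * B h.1 h.2).
  exists b0, B; split=> //; last by move=> u; have [] := HB u.
  by move=> k; rewrite nrm_conj bdd_box.
move=> [u h] /=; rewrite boxM box_conj /b0.
by have [_ ->] := HB u; rewrite -mulrA [_ * B _ _]mulrC.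
Qed.

Lemma avg_cubeS r (K : numFieldType) (a : cube r.+1 -> K) :
  avg a = \avg_ u \avg_ h a (u, h).
Proof. exact: avg_pair. Qed.

Definition boxavg r (a : cube r -> C) : C := \avg_ h \avg_ h' box a h h'.

Lemma boxavgS r (a : cube r.+1 -> C) :
  boxavg a = \avg_ u \avg_ u' boxavg (fun k => a (u, k) * (a (u', k))^*%C).
Proof.
rewrite /boxavg avg_cubeS; apply: eq_avg => u.
under eq_avg do rewrite avg_cubeS.
by rewrite exchange_avg.
Qed.

(** The innermost average is the square of the modulus of a mean. *)
Lemma boxavg_ge0 r (a : cube r -> C) : (0 < r)%N -> 0 <= boxavg a.
Proof.
case: r a => // r a _; elim: r a => [|r IHr] a; last first.
  by rewrite boxavgS; apply: avg_ge0 => u; apply: avg_ge0.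
rewrite boxavgS /boxavg /=.
under eq_avg do under eq_avg do rewrite !avg_cst ?card_unit//.
by rewrite -sqr_nrm_avg lecR sqr_ge0.
Qed.

Lemma nrm_avg_nneg (T : finType) (a : T -> C) :
  (forall t, 0 <= a t) -> nrm (avg a) = \avg_ t nrm (a t).
Proof.
move=> f0; apply: complexI; rewrite real_avg -nrmE ger0_norm ?avg_ge0 //.
by apply: eq_avg => x; rewrite -nrmE ger0_norm.
Qed.

(** Each coordinate of the cube is doubled once, and the factor independent of
    this coordinate is discarded at that moment. *)
Lemma box_cauchy_schwarz r (a B : cube r -> C) : degenerate B ->
  nrm (\avg_ h (a h * B h)) ^+ (2 ^ r) <= nrm (boxavg a).
Proof.
elim: r a B => [|r IHr] a B.
  move=> /= B1; rewrite expn0 expr1 /boxavg /= /avg !card_unit !divr1.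
  rewrite (eq_bigr (fun=> a tt)) ?sumr_const ?card_unit //.
  by move=> [] _; rewrite B1 mulr1.
move=> [b0 [B' [b0b dB EB]]].
pose W h u := a (u, h) * B' u h.
have -> : \avg_ h (a h * B h) = \avg_ h (b0 h * \avg_ u W h u).
  rewrite avg_cubeS exchange_avg; apply: eq_avg => h; rewrite -avgMl.
  by apply: eq_avg => u; rewrite EB mulrCA.
rewrite expnS exprM.
pose Z := \avg_ u \avg_ u' \avg_ h (W h u * (W h u')^*%C).
have leZ : nrm (\avg_ h (b0 h * \avg_ u W h u)) ^+ 2 <= nrm Z.
  apply: le_trans (van_der_corput W (card_cube_gt0 r) b0b) _.
  rewrite le_eqVlt; apply/orP; left; apply/eqP; congr nrm.
  rewrite exchange_avg; apply: eq_avg => u; exact: exchange_avg.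
have leW u u' : nrm (\avg_ h (W h u * (W h u')^*%C)) ^+ (2 ^ r)
    <= nrm (boxavg (fun k => a (u, k) * (a (u', k))^*%C)).
  apply: le_trans _ (IHr _ _ (degenerateM (dB u) (degenerate_conj (dB u')))).
  rewrite le_eqVlt; apply/orP; left; apply/eqP; congr (nrm _ ^+ _).
  by apply: eq_avg => h; rewrite /W rmorphM mulrACA.
have [r0|r0] := posnP r.
  subst r.
  (* Over a one-element cube the box average carries no positivity, but it is
     the very expression that Cauchy--Schwarz produces. *)
  rewrite expn0 expr1; apply: le_trans leZ _; rewrite boxavgS.
  rewrite le_eqVlt; apply/orP; left; apply/eqP; congr nrm.
  apply: eq_avg => u; apply: eq_avg => u'.
  rewrite /boxavg /= !avg_cst ?card_unit //.
  rewrite -[RHS](@avg_cst _ unit) ?card_unit //; apply: eq_avg => -[].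
  by rewrite /W !dB !mulr1.
rewrite boxavgS [leRHS]nrm_avg_nneg; last by move=> u; apply: avg_ge0 => u'; apply: boxavg_ge0.
under [leRHS]eq_avg => u.
  rewrite nrm_avg_nneg; last by move=> u'; apply: boxavg_ge0.
  over.
apply: le_trans (_ : nrm Z ^+ (2 ^ r) <= _).
  by rewrite lerXn2r ?nnegrE ?sqr_ge0 ?nrm_ge0.
apply: le_trans (_ : (\avg_ u \avg_ u' nrm (\avg_ h (W h u * (W h u')^*%C))) ^+ (2 ^ r) <= _).
  rewrite lerXn2r ?nnegrE ?nrm_ge0 //.
    by apply: avg_ge0 => u; apply: avg_ge0 => u'; apply: nrm_ge0.
  by apply: le_trans (nrm_avg _) _; apply: le_avg => u; apply: nrm_avg.
apply: le_trans (exp_avg_le _ _ _) _ => //.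
  by move=> u; apply: avg_ge0 => u'; apply: nrm_ge0.
apply: le_avg => u.
apply: le_trans (exp_avg_le _ _ _) _ => //; first by move=> u'; apply: nrm_ge0.
by apply: le_avg => u'.
Qed.

End Cubes.

(** * Degree lowering *)

Section DegreeLowering.
Variables (R : rcfType) (F : finFieldType).
Local Notation C := R[i].
Local Notation cube := (cube F).
Implicit Types (f g : F -> C) (x y : F).
Local Hint Extern 0 (is_true (0 < #|_|)%N) => exact: card_field_gt0 : core.

(** Conjugation depending on the parity of a vertex of the cube. *)
Definition cj (b : bool) (z : C) : C := if b then z^*%C else z.

Lemma nrm_cj b z : nrm (cj b z) = nrm z.
Proof. by case: b; rewrite //= nrm_conj. Qed.

Lemma cjM b z w : cj b (z * w) = cj b z * cj b w.
Proof. by case: b; rewrite //= rmorphM. Qed.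

Lemma cj_conj b z : (cj b z)^*%C = cj b z^*%C.
Proof. by case: b. Qed.

Lemma mder_mder h k f : mder h (mder k f) = mder k (mder h f).
Proof.
apply/funext => x; rewrite /mder !rmorphM /= -!mulrA; congr (_ * _).
by rewrite mulrCA [x + h + k]addrAC.
Qed.

Lemma mderc_mder r (h : cube r) k f x :
  mderc h (mder k f) x = mderc h f x * (mderc h f (x + k))^*%C.
Proof. by elim: r h f => //= r IHr h f; rewrite mder_mder IHr. Qed.

Lemma bdd_mderc r (h : cube r) f : bdd f -> bdd (mderc h f).
Proof. by elim: r h f => //= r IHr h f f1; apply: IHr; apply: bdd_mder. Qed.

Lemma unif_mderc r f : unif r.+1 f = \avg_(h : cube r) unif 1 (mderc h f).
Proof.
elim: r f => [|r IHr] f.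
  by rewrite -[RHS]/(\avg_(_ : unit) unif 1 f) avg_cst ?card_unit.
by rewrite avg_cubeS; apply: eq_avg => u; apply: IHr.
Qed.

(** For fixed [x], the only vertex of the cube that involves every coordinate
    of [h] is the last one. *)
Lemma mderc_split r f x : bdd f ->
  exists2 B, degenerate B &
    forall h : cube r, mderc h f x = cj (odd r) (f (x + csum h)) * B h.
Proof.
move=> f1; elim: r x => [|r IHr] x /=.
  by exists (fun=> 1) => // -[]; rewrite addr0 mulr1.
have [B HB] : {B : F -> cube r -> C & forall u, degenerate (B u) /\
    forall h, mderc h f (x + u) = cj (odd r) (f (x + u + csum h)) * B u h}.
  pose ok u (b : cube r -> C) := degenerate b /\
    forall h, mderc h f (x + u) = cj (odd r) (f (x + u + csum h)) * b h.
  apply: (@choice _ _ ok) => u.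
  by have [b bd bE] := IHr (x + u); exists b.
exists (fun h => mderc h.2 f x * (B h.1 h.2)^*%C).
  exists (fun h => mderc h f x), (fun u h => (B u h)^*%C); split=> //.
    by move=> h; apply: bdd_mderc.
  by move=> u; apply: degenerate_conj; have [] := HB u.
move=> [u h] /=; rewrite mderc_mder; have [_ ->] := HB u.
by rewrite rmorphM /= mulrCA addrA; congr (_ * _); case: (odd r); rewrite /= ?conjcK.
Qed.

(** The box spanned by [h] and [h'] only enters through the increments
    [h' - h], over which the uniformity norm averages. *)
Lemma boxavg_unif r g x :
  boxavg (fun h : cube r.+1 => g (x + csum h)) = (unif r g)%:C%C.
Proof.
elim: r g x => [|r IHr] g x.
  rewrite boxavgS /boxavg /= sqr_nrm_avg.
  rewrite -[RHS](avg_shift _ x); apply: eq_avg => u.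
  rewrite -[RHS](avg_shift _ x); apply: eq_avg => u'.
  by rewrite !avg_cst ?card_unit // !addr0.
rewrite boxavgS; transitivity (\avg_ u \avg_ u' (unif r (mder (u' - u) g))%:C%C : C).
  apply: eq_avg => u; apply: eq_avg => u'; rewrite -(IHr _ (x + u)).
  congr boxavg; apply/funext => h /=; rewrite /mder; congr (g _ * (g _)^*%C); ring.
rewrite [RHS]real_avg -[RHS](@avg_cst _ F) //; apply: eq_avg => u.
by rewrite -[LHS](avg_shift _ u); apply: eq_avg => h; rewrite addrC addKr.
Qed.

Lemma boxavg_conj r (a : cube r -> C) :
  boxavg (fun h => (a h)^*%C) = (boxavg a)^*%C.
Proof.
rewrite /boxavg conj_avg; apply: eq_avg => h; rewrite conj_avg.
by apply: eq_avg => h'; rewrite box_conj.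
Qed.

Lemma nrm_boxavg_cj r (b : bool) g x :
  nrm (boxavg (fun h : cube r.+1 => cj b (g (x + csum h)))) = unif r g.
Proof.
case: b; rewrite /cj ?boxavg_conj ?nrm_conj boxavg_unif nrmR //;
exact: unif_ge0.
Qed.

Definition shift_prod (t : seq (bool * F)) g x := \prod_(z <- t) cj z.1 (g (x + z.2)).

(** The list of translations depends on the box alone, so that the average over
    [x] and [y] of such a product falls under a hypothesis on all lists. *)
Lemma box_shift_prod r (h h' : cube r) b :
  exists t, forall g x,
    box (fun k : cube r => cj b (g (x + csum k))) h h' = shift_prod t g x.
Proof.
pose t0 := [:: (b, 0 : F)].
have [t tE] : exists t, forall g x,
    box (fun k : cube r => shift_prod t0 g (x + csum k)) h h' = shift_prod t g x.
  elim: r t0 h h' => [|r IHr] t0 h h'; first by exists t0 => g x /=; rewrite addr0.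
  have [t tE] := IHr ([seq (z.1, z.2 + h.1) | z <- t0] ++
                      [seq (~~ z.1, z.2 + h'.1) | z <- t0]) h.2 h'.2.
  exists t => g x; rewrite -tE /=; congr (box _ _ _); apply/funext => k.
  rewrite /shift_prod big_cat !big_map rmorph_prod; congr (_ * _).
    by apply: eq_bigr => z _; congr (cj _ (g _)) => /=; ring.
  apply: eq_bigr => z _ /=; rewrite cj_conj.
  have -> : x + (h'.1 + csum k) + z.2 = x + csum k + (z.2 + h'.1) by ring.
  by case: z.1; rewrite /= ?conjcK.
exists t => g x; rewrite -tE; congr (box _ _ _); apply/funext => k.
by rewrite /shift_prod big_seq1 /= addr0.
Qed.

Lemma box_real r (w : cube r -> R) (h h' : cube r) :
    (forall k, 0 <= w k <= 1) ->
  exists2 v, box (fun k => (w k)%:C%C) h h' = v%:C%C & 0 <= v <= w h.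
Proof.
elim: r w h h' => [|r IHr] w h h' w1 /=.
  by exists (w tt) => //; case: h; rewrite lexx; have /andP[->] := w1 tt.
have [k|v vE /andP[v0 vw]] := IHr (fun k => w (h.1, k) * w (h'.1, k)) h.2 h'.2.
  have /andP[a0 a1] := w1 (h.1, k); have /andP[b0 b1] := w1 (h'.1, k).
  by rewrite mulr_ge0 ?mulr_ile1.
exists v.
  by rewrite -vE; congr (box _ _ _); apply/funext => k; rewrite rmorphM /= oppr0.
rewrite v0 (le_trans vw) //; case: h {v vE v0 vw} => u h /=.
by rewrite ler_piMr //; [case/andP: (w1 (u, h))|case/andP: (w1 (h'.1, h))].
Qed.

Lemma box_char r (e : F -> C) (phi : cube r -> F) (h h' : cube r) :
    additive_char e ->
  exists a, forall x, box (fun k => e (phi k * x)) h h' = e (a * x).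
Proof.
move=> eC; elim: r phi h h' => [|r IHr] phi h h'; first by exists (phi tt).
have [a aE] := IHr (fun k => phi (h.1, k) - phi (h'.1, k)) h.2 h'.2.
exists a => x; rewrite -aE /=; congr (box _ _ _); apply/funext => k.
by have [eD _ _] := eC; rewrite -(charN eC) -eD mulrBl.
Qed.

End DegreeLowering.

Section DegreeLoweringStep.
Variables (R : rcfType) (F : finFieldType).
Local Notation C := R[i].
Local Notation cube := (cube F).
Implicit Types (f g : F -> C).
Local Hint Extern 0 (is_true (0 < #|_|)%N) => exact: card_field_gt0 : core.
Local Hint Resolve card_cube_gt0 : core.

Variable e : F -> C.
Hypothesis e_char : additive_char e.

Lemma avg2_exp_le (T S : finType) (c : T -> S -> C) n :
    (0 < #|T|)%N -> (0 < #|S|)%N ->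
  nrm (\avg_ x \avg_ y c x y) ^+ n <= \avg_ x \avg_ y nrm (c x y) ^+ n.
Proof.
move=> T0 S0.
have c0 x : 0 <= \avg_ y nrm (c x y) by apply: avg_ge0 => y; apply: nrm_ge0.
apply: (@le_trans _ _ ((\avg_ x \avg_ y nrm (c x y)) ^+ n)).
  rewrite lerXn2r ?nnegrE ?nrm_ge0 ?avg_ge0 //.
  by apply: le_trans (nrm_avg _) _; apply: le_avg => x; apply: nrm_avg.
apply: le_trans (exp_avg_le _ T0 c0) _; apply: le_avg => x.
by apply: exp_avg_le => // y; apply: nrm_ge0.
Qed.

(** Expanding the square introduces one more derivative, in a direction [t].
    For fixed [x] and [t] the derivatives of [mder t G] are its values at
    [x + csum h] times degenerate functions of [h]; all degenerate factors, [D]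
    included, are discarded by the box Cauchy--Schwarz inequality. *)
Lemma degenerate_correlation r G (D : F -> cube r.+1 -> C) :
    bdd G -> (forall x, degenerate (D x)) ->
  (\avg_ h nrm (\avg_ x (mderc h G x * D x h)) ^+ 2) ^+ (2 ^ r.+1)
    <= unif r.+1 G.
Proof.
move=> G1 dD.
have [B HB] : {B : F * F -> cube r.+1 -> C & forall z, degenerate (B z) /\
    forall h, mderc h (mder z.2 G) z.1
      = cj (odd r.+1) (mder z.2 G (z.1 + csum h)) * B z h}.
  pose ok (z : F * F) (b : cube r.+1 -> C) := degenerate b /\
    forall h, mderc h (mder z.2 G) z.1
      = cj (odd r.+1) (mder z.2 G (z.1 + csum h)) * b h.
  apply: (@choice _ _ ok) => z.
  by have [b bd bE] := mderc_split r.+1 z.1 (bdd_mder z.2 G1); exists b.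
set T := avg _; have T0 : 0 <= T by apply: avg_ge0 => h; apply: sqr_ge0.
have TE : T%:C%C = \avg_ x \avg_ t \avg_(h : cube r.+1)
    (cj (odd r.+1) (mder t G (x + csum h))
      * (B (x, t) h * (D x h * (D (x + t) h)^*%C))).
  rewrite real_avg; transitivity (\avg_(h : cube r.+1) \avg_ x \avg_ t
      (cj (odd r.+1) (mder t G (x + csum h))
      * (B (x, t) h * (D x h * (D (x + t) h)^*%C)))).
    apply: eq_avg => h; rewrite sqr_nrm_avg; apply: eq_avg => x.
    rewrite -(avg_shift _ x); apply: eq_avg => t.
    rewrite [(_ * D _ _)^*%C]rmorphM mulrACA -[X in X * _]mderc_mder [RHS]mulrA; congr (_ * _).
    by have [_ HBh] := HB (x, t); exact: HBh h.
  rewrite exchange_avg; apply: eq_avg => x; exact: exchange_avg.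
rewrite -(nrmR T0) TE; apply: le_trans (avg2_exp_le _ _ _ _) _ => //.
rewrite -[leRHS](@avg_cst _ F) //; apply: le_avg => x; apply: le_avg => t.
apply: le_trans (box_cauchy_schwarz _ _) _.
  apply: degenerateM; first by have [] := HB (x, t).
  by apply: degenerateM (dD x) (degenerate_conj (dD _)).
by rewrite nrm_boxavg_cj.
Qed.

(** A large norm of [G] yields frequencies [phi h] at which its derivatives
    correlate with characters.  Cauchy--Schwarz turns this into correlations of
    products of translates of the [Fy y] with characters whose frequencies are
    the alternating sums of [phi] over boxes.  These sums must therefore vanish
    on most boxes, which makes [phi] a sum of functions of fewer variables. *)
Lemma degree_lowering (Fy : F -> F -> C) (eps : R) r :
    (forall y, bdd (Fy y)) ->
    (forall t a, a != 0 ->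
       nrm (\avg_ x \avg_ y (shift_prod t (Fy y) x * e (a * x))) <= eps) ->
  let G x := \avg_ y Fy y x in
  exists X, [/\ 0 <= X, unif r.+1 G ^+ (2 ^ r.+1) <= eps ^+ 2 + X
              & X ^+ (2 ^ r) <= unif r G].
Proof.
move=> F1 Feps G; have [eD e1 _] := e_char.
have G1 : bdd G by move=> x; apply: nrm_avg_le1 => // y; apply: F1.
case: r => [|r].
  exists (unif 0 G); split; [exact: unif_ge0| |by []].
  apply: (@le_trans _ _ (unif 1 G)).
    by rewrite exprS expr1 ler_piMr ?unif_ge0 ?unif_le1.
  have [a] := unif1_le_fourier e_char G1; have [->|a0] := eqVneq a 0.
    move=> le1; apply: le_trans le1 _; rewrite ler_wpDl ?sqr_ge0 //.
    rewrite le_eqVlt; apply/orP; left; apply/eqP; congr (nrm _ ^+ _).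
    by apply: eq_avg => x; rewrite mul0r (char0 e_char) mulr1.
  move=> le1; apply: le_trans le1 _; rewrite ler_wpDr ?unif_ge0 //.
  have := Feps [:: (false, 0)] a a0.
  have -> : \avg_ x \avg_ y (shift_prod [:: (false, 0)] (Fy y) x * e (a * x))
          = fourier e G a.
    apply: eq_avg => x; rewrite avgMr; congr (_ * _); apply: eq_avg => y.
    by rewrite /shift_prod big_seq1 /= addr0.
  move=> le_eps; rewrite lerXn2r ?nnegrE ?nrm_ge0 //.
  exact: le_trans (nrm_ge0 _) le_eps.
(* A frequency at which the derivative of [G] correlates with a character. *)
have [phi phiP] := choice (fun h : cube r.+1 =>
  unif1_le_fourier e_char (bdd_mderc h G1)).
(* Keeping [w] as a weight retains, after Cauchy--Schwarz, only those [h] at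
   which the derivative of [G] does correlate with its character. *)
pose w (h : cube r.+1) := nrm (fourier e (mderc h G) (phi h)) ^+ 2.
have w01 h : 0 <= w h <= 1.
  rewrite sqr_ge0 expr_le1 ?nrm_ge0 //; apply: nrm_avg_le1 => // x.
  by rewrite nrmM_le1 ?e1 //; apply: bdd_mderc.
have [B HB] : {B : F -> cube r.+1 -> C & forall x, degenerate (B x) /\
    forall h, mderc h G x = cj (odd r.+1) (G (x + csum h)) * B x h}.
  pose ok x (b : cube r.+1 -> C) := degenerate b /\
    forall h, mderc h G x = cj (odd r.+1) (G (x + csum h)) * b h.
  apply: (@choice _ _ ok) => x.
  by have [b bd bE] := mderc_split r.+1 x G1; exists b.
pose P (z : F * F) (h : cube r.+1) :=
  cj (odd r.+1) (Fy z.2 (z.1 + csum h)) * e (phi h * z.1).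
have [ph phP] : {a : cube r.+1 * cube r.+1 -> F & forall hh x,
    box (fun k => e (phi k * x)) hh.1 hh.2 = e (a hh * x)}.
  pose ok (hh : cube r.+1 * cube r.+1) (a : F) := forall x,
    box (fun k => e (phi k * x)) hh.1 hh.2 = e (a * x).
  by apply: (@choice _ _ ok) => hh; apply: box_char.
pose X := \avg_ h' \avg_ h ((ph (h, h') == 0)%:R * w h).
have X0 : 0 <= X.
  by apply: avg_ge0 => h'; apply: avg_ge0 => h; rewrite mulr_ge0 ?ler0n ?sqr_ge0.
exists X; split=> //; last first.
  apply: le_trans (exp_avg_le _ _ _) _ => //.
    by move=> h'; apply: avg_ge0 => h; rewrite mulr_ge0 ?ler0n ?sqr_ge0.
  apply: avg_le_cst => // h'.
  have [D HD] : {D : F -> cube r.+1 -> C & forall x, degenerate (D x) /\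
      forall h, box (fun k => e (phi k * x)) h h' = e (phi h * x) * D x h}.
    pose ok x (b : cube r.+1 -> C) := degenerate b /\
      forall h, box (fun k => e (phi k * x)) h h' = e (phi h * x) * b h.
    apply: (@choice _ _ ok) => x.
    have [|b bd bE] := @box_split _ _ _ (fun k => e (phi k * x)) h'.
      by move=> k; rewrite e1.
    by exists b.
  apply: le_trans _ (degenerate_correlation (D := fun x h => (D x h)^*%C) G1 _).
    rewrite lerXn2r ?nnegrE ?avg_ge0 //.
    - by move=> h; rewrite mulr_ge0 ?ler0n ?sqr_ge0.
    - by move=> h; rewrite sqr_ge0.
    apply: le_avg => h; case: eqVneq => [ph0|_]; last by rewrite mul0r sqr_ge0.
    rewrite mul1r le_eqVlt; apply/orP; left; apply/eqP; congr (nrm _ ^+ _).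
    apply: eq_avg => x; congr (_ * _).
    have [_ /(_ h)] := HD x; rewrite (phP (h, h')) ph0 mul0r (char0 e_char) => eD1.
    have : e (phi h * x) * D x h = e (phi h * x) * (e (phi h * x))^*%C.
      by rewrite -eD1 mul_conj e1 expr1n.
    have e0 : e (phi h * x) != 0.
      by apply/eqP => e0; move: eD1; rewrite e0 mul0r => /eqP; rewrite oner_eq0.
    by move=> /(mulfI e0)->; rewrite conjcK.
  by move=> x; apply: degenerate_conj; have [] := HD x.
apply: (@le_trans _ _ ((\avg_ h w h ^+ 2) ^+ (2 ^ r.+1))).
  rewrite expnS exprM lerXn2r ?nnegrE ?sqr_ge0 //.
    by apply: avg_ge0 => h; rewrite sqr_ge0.
  rewrite unif_mderc; apply: le_trans (exp_avg_le _ _ _) _ => //.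
    by move=> h; apply: unif_ge0.
  by apply: le_avg => h; rewrite lerXn2r ?nnegrE ?unif_ge0 ?sqr_ge0 // phiP.
pose a z z' h := (w h)%:C%C * (P z h * (P z' h)^*%C).
have wE : (\avg_ h w h ^+ 2)%:C%C
    = \avg_ z \avg_ z' \avg_ h (a z z' h * (B z.1 h * (B z'.1 h)^*%C)).
  rewrite real_avg; transitivity (\avg_ h \avg_ z \avg_ z'
      (a z z' h * (B z.1 h * (B z'.1 h)^*%C))).
    apply: eq_avg => h; rewrite exprS expr1 rmorphM /= {2}/w.
    have -> : fourier e (mderc h G) (phi h) = \avg_ z (P z h * B z.1 h).
      rewrite avg_pair; apply: eq_avg => x; have [_ ->] := HB x.
      transitivity ((\avg_ y cj (odd r.+1) (Fy y (x + csum h)))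
          * e (phi h * x) * B x h); last by rewrite -!avgMr.
      rewrite mulrAC; congr (_ * _ * _).
      by rewrite /cj; case: (odd r.+1); rewrite ?conj_avg.
    rewrite [X in _ * X]sqr_nrm_avg -(avgMl (w h)%:C%C); apply: eq_avg => z.
    rewrite -(avgMl (w h)%:C%C); apply: eq_avg => z'.
    rewrite [(_ * B _ _)^*%C]rmorphM /a; ring.
  rewrite exchange_avg; apply: eq_avg => z; exact: exchange_avg.
have w2_ge0 : 0 <= \avg_ h w h ^+ 2 by apply: avg_ge0 => h; rewrite sqr_ge0.
have FF0 : (0 < #|{: F * F}|)%N by rewrite card_prod muln_gt0 card_field_gt0.
rewrite -(nrmR w2_ge0) wE; apply: le_trans (avg2_exp_le _ _ _ _) _ => //.
apply: (@le_trans _ _ (\avg_ z \avg_ z' nrm (boxavg (a z z')))).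
  apply: le_avg => z; apply: le_avg => z'; apply: box_cauchy_schwarz.
  apply: degenerateM; first by have [] := HB z.1.
  by apply: degenerate_conj; have [] := HB z'.1.
have -> : \avg_ z \avg_ z' nrm (boxavg (a z z'))
    = nrm (\avg_ z \avg_ z' boxavg (a z z')).
  rewrite [RHS]nrm_avg_nneg; last first.
    by move=> z; apply: avg_ge0 => z'; apply: boxavg_ge0.
  apply: eq_avg => z; rewrite [RHS]nrm_avg_nneg // => z'; exact: boxavg_ge0.
have -> : \avg_ z \avg_ z' boxavg (a z z')
    = \avg_ h' \avg_ h \avg_ z \avg_ z' box (a z z') h h'.
  rewrite [RHS]exchange_avg.
  transitivity (\avg_ z \avg_ h \avg_ h' \avg_ z' box (a z z') h h').
    apply: eq_avg => z; rewrite /boxavg [LHS]exchange_avg; apply: eq_avg => h.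
    exact: exchange_avg.
  by rewrite [LHS]exchange_avg; apply: eq_avg => h; exact: exchange_avg.
rewrite -[eps ^+ 2](@avg_cst _ (cube r.+1)) // -avgD.
apply: le_trans (nrm_avg _) _; apply: le_avg => h'.
rewrite -[eps ^+ 2](@avg_cst _ (cube r.+1)) // -avgD.
apply: le_trans (nrm_avg _) _; apply: le_avg => h.
have [v vE /andP[v0 vw]] := box_real h h' w01.
have [t tE] := box_shift_prod R h h' (odd r.+1).
have v1 : v <= 1 by apply: le_trans vw _; case/andP: (w01 h).
have -> : \avg_ z \avg_ z' box (a z z') h h'
    = (v * nrm (\avg_ x \avg_ y (shift_prod t (Fy y) x * e (ph (h, h') * x))) ^+ 2)%:C%C.
  rewrite rmorphM /= -(avg_pair (fun z : F * F =>
     shift_prod t (Fy z.2) z.1 * e (ph (h, h') * z.1))) sqr_nrm_avg.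
  rewrite -avgMl; apply: eq_avg => z; rewrite -avgMl; apply: eq_avg => z'.
  have boxP u : box (P u) h h'
      = shift_prod t (Fy u.2) u.1 * e (ph (h, h') * u.1).
    by rewrite -tE -(phP (h, h')) -boxM.
  by rewrite -!boxP -box_conj -boxM -vE -boxM.
set S := nrm (avg _); have S0 : 0 <= S := nrm_ge0 _.
rewrite nrmR ?mulr_ge0 ?sqr_ge0 //.
case: (eqVneq (ph (h, h')) 0) => [_|pn0].
  rewrite mul1r ler_wpDl ?sqr_ge0 //; apply: le_trans _ vw.
  rewrite ler_piMr // expr_le1 //; apply: nrm_avg_le1 => // x.
  apply: nrm_avg_le1 => // y; rewrite nrmM_le1 ?e1 //.
  by apply: nrm_prod_le1 => z _; rewrite nrm_cj; apply: F1.
rewrite mul0r addr0; have leS := Feps t _ pn0.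
apply: (@le_trans _ _ (S ^+ 2)); first by rewrite ler_piMl ?sqr_ge0.
by rewrite lerXn2r ?nnegrE // (le_trans S0 leS).
Qed.

End DegreeLoweringStep.

(** * Power savings *)

Section Small.
Variable R : rcfType.
Implicit Types (d X Y : R) (p q : nat * nat).

(** A quantity at most a constant times a positive power of [d], in a form that
    avoids roots: [p] holds the inverse of the exponent and the constant. *)
Definition small d p X := 0 <= X /\ X ^+ p.1 <= p.2%:R * d.

Lemma expD_le X Y n : 0 <= X -> 0 <= Y -> (X + Y) ^+ n <= 2 ^+ n * (X ^+ n + Y ^+ n).
Proof.
move=> X0 Y0; wlog XY : X Y X0 Y0 / X <= Y => [H|].
  have [XY|/ltW YX] := leP X Y; first exact: H.
  by rewrite addrC [X ^+ n + _]addrC; apply: H.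
apply: (@le_trans _ _ ((2 * Y) ^+ n)); last first.
  by rewrite exprMn ler_wpM2l ?exprn_ge0 // lerDr exprn_ge0.
by rewrite lerXn2r ?nnegrE ?addr_ge0 ?mulr_ge0 // mulr_natl mulr2n lerD2r.
Qed.

Lemma small_le d p X Y : 0 <= X -> X <= Y -> small d p Y -> small d p X.
Proof.
move=> X0 XY [Y0 Yp]; split=> //; apply: le_trans Yp.
by rewrite lerXn2r ?nnegrE.
Qed.

Lemma small_root d p n c X Y :
  0 <= X -> X ^+ n <= c%:R * Y -> small d p Y -> small d (n * p.1, c ^ p.1 * p.2)%N X.
Proof.
move=> X0 XY [Y0 Yp]; split=> //=; rewrite exprM.
apply: (@le_trans _ _ ((c%:R * Y) ^+ p.1)).
  by rewrite lerXn2r ?nnegrE ?exprn_ge0 ?mulr_ge0 ?ler0n.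
by rewrite exprMn natrM natrX -mulrA ler_wpM2l ?exprn_ge0 ?ler0n.
Qed.

Lemma small_weaken d p q X : 0 <= d -> X <= 1 -> (p.1 <= q.1)%N -> (p.2 <= q.2)%N ->
  small d p X -> small d q X.
Proof.
move=> d0 X1 pq1 pq2 [X0 Xp]; split=> //.
apply: (@le_trans _ _ (X ^+ p.1)); first by rewrite ler_wiXn2l.
by apply: le_trans Xp _; rewrite ler_wpM2r // ler_nat.
Qed.

Lemma small_add d n K L X Y :
  small d (n, K) X -> small d (n, L) Y -> small d (n, 2 ^ n * (K + L))%N (X + Y).
Proof.
move=> [X0 Xp] [Y0 Yp]; split; first by rewrite addr_ge0.
apply: le_trans (expD_le _ _ _) _ => //=.
by rewrite natrM natrX natrD -mulrA mulrDl ler_wpM2l ?exprn_ge0 // lerD.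
Qed.

Lemma small_sum n K s : exists q, forall d (a : nat -> R), 0 <= d ->
  (forall i, (i < s)%N -> small d (n.+1, K) (a i)) ->
  small d q (\sum_(i < s) a i).
Proof.
suff [L HL] : exists L, forall d (a : nat -> R), 0 <= d ->
    (forall i, (i < s)%N -> small d (n.+1, K) (a i)) ->
    small d (n.+1, L) (\sum_(i < s) a i) by exists (n.+1, L).
elim: s => [|s [L HL]].
  by exists 0%N => d a d0 _; rewrite big_ord0; split=> //; rewrite expr0n mul0r.
exists (2 ^ n.+1 * (L + K))%N => d a d0 aP; rewrite big_ord_recr /=.
by apply: small_add; [apply: HL => // i si; apply: aP; apply: ltnW|apply: aP].
Qed.

Lemma exists_root n (c : R) : 0 <= c -> exists2 x : R, 0 <= x & x ^+ n.+1 = c.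
Proof.
move=> c0; pose p : {poly R} := 'X^(n.+1) - c%:P.
have [||x /andP[x0 _] px] := @poly_ivt R p 0 (c + 1).
- by rewrite addr_ge0.
- rewrite /p !hornerE expr0n /= sub0r oppr_le0 c0 /= subr_ge0.
  have c1 : 1 <= c + 1 by rewrite lerDr.
  by rewrite (@le_trans _ _ (c + 1)) ?lerDl // exprS ler_peMr ?addr_ge0 // exprn_ege1.
exists x => //; move: px; rewrite /root /p !hornerE subr_eq0; exact: eqP.
Qed.

End Small.

(** * Polynomial progressions: control and the purely exponential case *)

Section Progressions.
Variable R : rcfType.
Local Notation C := R[i].
Local Hint Extern 0 (is_true (0 < #|_|)%N) => exact: card_field_gt0 : core.

Definition prog (F : finFieldType) n (Q : 'I_n -> {poly F}) (f : 'I_n -> F -> C) : C :=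
  \avg_ x \avg_ y \prod_i f i (x + (Q i).[y]).

(** The first [m] polynomials stand for those of an arithmetic progression, the
    others for the polynomial terms. *)
Record good_system (D m n : nat) (F : finFieldType) (Q : 'I_n -> {poly F}) : Prop :=
  GoodSystem {
    gs_char : char_gt D F;
    gs_size : forall i, (size (Q i) <= D.+1)%N;
    gs_linear : forall i : 'I_n, (i < m)%N -> (size (Q i) <= 2)%N;
    gs_zero : forall i : 'I_n, i = 0%N :> nat -> Q i = 0;
    gs_distinct : forall l i : 'I_n, (m <= l)%N -> i != l ->
      (1 < size (Q l - Q i)%R)%N;
    gs_indep : forall a : 'I_n -> F,
      (exists2 i : 'I_n, (m <= i)%N & a i != 0) ->
      (m < size (\sum_(i < n | (m <= i)%N) a i *: Q i)%R)%N
  }.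

Lemma nrm_prog_le1 (F : finFieldType) n (Q : 'I_n -> {poly F}) f :
  (forall i, bdd (f i)) -> nrm (prog Q f) <= 1.
Proof.
move=> f1; apply: nrm_avg_le1 => // x; apply: nrm_avg_le1 => // y.
by apply: nrm_prod_le1 => i _; apply: f1.
Qed.

(** Subtracting the polynomial furthest in degree from the [l]-th one makes the
    [l]-th polynomial one of maximal degree. *)
Lemma target_control D m n : (0 < m)%N -> exists N K s, forall (F : finFieldType)
    (Q : 'I_n -> {poly F}) (f : 'I_n -> F -> C) (l : 'I_n),
  good_system D m Q -> (m <= l)%N -> (forall i, bdd (f i)) ->
  nrm (prog Q f) ^+ N <= K%:R * (\sum_(i < s) unif i (f l) + #|F|%:R^-1).
Proof.
move=> m0; have [N [K [s H]]] := @pet R D (fun=> n.+1) n; exists N, K, s.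
move=> F Q f l [cF sQ _ _ dQ _] ml f1.
have n0 : (0 < n)%N by apply: leq_ltn_trans (ltn_ord l).
pose i0 := Ordinal n0.
have i0l : i0 != l by apply/negP => /eqP E; move: ml m0; rewrite -E /=; lia.
pose j := [arg max_(i > i0 | i != l) size (Q l - Q i)%R]%N.
have [jl jmax] : j != l /\ forall i, i != l ->
    (size (Q l - Q i)%R <= size (Q l - Q j)%R)%N.
  by rewrite /j; case: arg_maxnP.
pose L := [seq (f i, Q i - Q j) | i <- rem l (enum 'I_n)].
have remP i : i \in rem l (enum 'I_n) -> i != l.
  by rewrite mem_rem_uniq ?enum_uniq // inE => /andP[].
have -> : prog Q f = config (f l) (Q l - Q j) L.
  rewrite /prog /config (shear_avg _ (fun y => - (Q j).[y])).
  apply: eq_avg => x; apply: eq_avg => y.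
  rewrite -(big_enum _ _ xpredT) /= (big_rem l) ?mem_enum //= big_map.
  rewrite hornerD hornerN; congr (f l _ * _); first ring.
  by apply: eq_bigr => i _ /=; rewrite hornerD hornerN; congr (f i _); ring.
have sj := dQ l j ml jl.
have sizeB i : (size (Q l - Q i)%R <= D.+1)%N.
  by rewrite (leq_trans (size_polyD _ _)) // size_polyN geq_max !sQ.
have sL : size L = n.-1.
  by rewrite size_map size_rem ?mem_enum // size_enum_ord.
apply: (H F (f l) (Q l - Q j) L (size (Q l - Q j)).-1) => //.
- by move=> z /mapP[i _ ->]; apply: f1.
- by have := sizeB j; lia.
- by rewrite prednK //; lia.
- move=> z /mapP[i /remP il ->] /=.
  have -> : Q i - Q j = (Q l - Q j) - (Q l - Q i) by ring.
  rewrite prednK ?(ltnW sj) //.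
  by rewrite (leq_trans (size_polyD _ _)) // size_polyN geq_max leqnn jmax.
- move=> z /mapP[i /remP il ->] /=.
  by rewrite opprB addrA subrK dQ.
- by rewrite sL leq_pred.
- move=> i _; apply: leq_trans (size_leads _ _) _.
  by rewrite /= size_map sL prednK.
Qed.

(** Each derivative lowers the degree of the phase by one; after [d] of them it
    is linear in [y], and its average vanishes unless one of the [d] increments
    is zero. *)
Lemma unif_poly_phase (F : finFieldType) (e : F -> C) (P : {poly F}) d :
    additive_char e -> char_gt d.+1 F -> size P = d.+2 ->
  unif d (fun y => e P.[y]) <= d%:R / #|F|%:R.
Proof.
move=> eC; have [eD e1 _] := eC.
elim: d P => [|d IHd] P cF sP /=.
  have -> : avg (fun y => e P.[y]) = 0.
    have P1 : P`_1 != 0.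
      have : lead_coef P != 0 by rewrite lead_coef_eq0 -size_poly_eq0 sP.
      by rewrite lead_coefE sP.
    rewrite -(mulr0 (e P`_0)) -(avg_char eC P1) -avgMl; apply: eq_avg => y.
    rewrite -eD (horner_coef_wide _ (_ : (size P <= 2)%N)) ?sP //.
    by rewrite !big_ord_recl big_ord0 /= expr0 expr1 mulr1 addr0.
  by rewrite nrm0 expr0n /= mul0r.
have bad : forall h, h \notin [set 0 : F] ->
    unif d (mder h (fun y => e P.[y])) <= d%:R / #|F|%:R.
  move=> h; rewrite inE => h0.
  have -> : mder h (fun y => e P.[y]) = fun y => e (P - shiftp h P).[y].
    apply/funext => y; rewrite /mder -(charN eC) -eD.
    by rewrite hornerD hornerN horner_shiftp.
  apply: IHd => [i /andP[i0 id]|].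
    by apply: cF; rewrite i0 ltnW.
  by apply: size_sub_shift => //; apply: cF; rewrite /= ltnS leqnn.
have P1 h : bdd (mder h (fun y => e P.[y])).
  by apply: bdd_mder => y; rewrite e1.
apply: le_trans (avg_exceptional _ (fun h => unif_le1 _ (P1 h)) bad) _.
  by rewrite divr_ge0 ?ler0n.
by rewrite cards1 -mulrDl natr1.
Qed.

Definition chars_small (D m n s : nat) p :=
  forall (F : finFieldType) (e : F -> C) (Q : 'I_n -> {poly F})
    (f : 'I_n -> F -> C) (k : 'I_n -> C) (a : 'I_n -> F),
  good_system D m Q -> additive_char e -> (forall i, bdd (f i)) ->
  (forall i : 'I_n, (s <= i)%N -> nrm (k i) <= 1 /\ forall x, f i x = k i * e (a i * x)) ->
  (exists2 i : 'I_n, (s <= i)%N & a i != 0) ->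
  small #|F|%:R^-1 p (nrm (prog Q f)).

(** The characters of [x] are absorbed by the function of index zero, whose
    argument is [x] itself; their values at the polynomials form a phase [P] of
    degree at least [m].  Removing the [m] linear terms leaves a uniformity norm
    of this phase. *)
Lemma prog_characters D m n : (0 < m)%N ->
  exists p, (0 < p.1)%N /\ chars_small D m n m p.
Proof.
move=> m0; exists (2 ^ D, D)%N; split=> [|F e Q f k a [cF sQ lQ zQ dQ iQ] eC f1 fk ak].
  by rewrite expn_gt0.
have [eD e1 _] := eC; split; first exact: nrm_ge0.
pose P := \sum_(i < n | (m <= i)%N) a i *: Q i.
pose A := \sum_(i < n | (m <= i)%N) a i.
have n0 : (0 < n)%N by case: ak => i _ _; apply: leq_ltn_trans (ltn_ord i).
pose i0 := Ordinal n0.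
have sP : (m < size P)%N by apply: iQ.
have sPD : (size P <= D.+1)%N.
  rewrite (leq_trans (size_sum _ _ _)) //; apply/bigmax_leqP => i _.
  by rewrite (leq_trans (size_scale_leq _ _)).
have [d dP] : exists d, size P = d.+2 by exists (size P - 2)%N; lia.
pose g (i : 'I_n) x := f i (x + (Q i)`_0) * (if i == i0 then e (A * x) else 1).
pose L0 := [seq (g i, (Q i)`_1) | i <- [seq i : 'I_n <- enum 'I_n | (i < m)%N]].
(* Constant functions are added until the order of the norm is the degree of
   the phase. *)
pose one : (F -> C) * F := ((fun=> 1), 0).
have sL0 : (0 < size L0 <= d.+1)%N.
  rewrite size_map size_filter -has_count; apply/andP; split.
    by apply/hasP; exists i0; rewrite ?mem_enum.
  rewrite -size_filter; apply: (@leq_trans m); last by lia.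
  rewrite -[leqRHS](size_iota 0 m) -[leqLHS](size_map (@nat_of_ord n)).
  apply: uniq_leq_size.
    by rewrite (map_inj_uniq (@ord_inj n)) filter_uniq // enum_uniq.
  move=> x xP; have [i iP ->] := @mapP 'I_n nat (@nat_of_ord n) _ x xP.
  by rewrite mem_iota; move: iP; rewrite mem_filter => /andP[].
pose L := L0 ++ nseq (d.+1 - size L0) one.
have sL : size L = d.+1 by rewrite size_cat size_nseq subnKC //; case/andP: sL0.
have LP z : z \in L -> bdd z.1 /\ (1 : F) != 0 * z.2.
  rewrite mem_cat mul0r oner_eq0; split=> //; move: H => /orP[/mapP[i _ ->]|].
    move=> x; rewrite nrmM_le1 ?f1 //.
    by case: ifP => _; rewrite ?e1 ?nrm1.
  by rewrite mem_nseq => /andP[_ /eqP->] x; rewrite nrm1.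
have progE : prog Q f = (\prod_(i < n | (m <= i)%N) k i)
   * \avg_ x \avg_ y (e P.[0 * x + 1 * y] * \prod_(z <- L) z.1 (x + z.2 * y)).
  rewrite /prog -avgMl; apply: eq_avg => x; rewrite -avgMl; apply: eq_avg => y.
  rewrite mul0r add0r mul1r big_cat /= big_nseq.
  have -> : iter (d.+1 - size L0) ( *%R (one.1 (x + one.2 * y))) 1 = 1.
    by elim: (_ - _)%N => //= j ->; rewrite mulr1.
  rewrite mulr1 big_map big_filter big_enum_cond /=.
  have -> : \prod_(i < n | (i < m)%N) g i (x + (Q i)`_1 * y)
      = (\prod_(i < n | (i < m)%N) f i (x + (Q i).[y])) * e (A * x).
    rewrite big_split /=; congr (_ * _).
      apply: eq_bigr => i im; congr (f i _); rewrite -addrA; congr (_ + _).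
      rewrite (horner_coef_wide _ (lQ i im)) !big_ord_recl big_ord0 /=.
      by rewrite expr0 expr1 mulr1 addr0 addrC.
    rewrite (bigD1 i0) //= ?eqxx zQ // coef0 mul0r addr0.
    by rewrite big1 ?mulr1 // => i /andP[_ /negPf->].
  rewrite (bigID (fun i : 'I_n => m <= i)%N) /=.
  rewrite (eq_bigr (fun i => k i * e (a i * (x + (Q i).[y])))); last first.
    by move=> i mi; have [_ ->] := fk i mi.
  rewrite big_split /= -!mulrA; congr (_ * _).
  rewrite -(big_morph e eD (char0 eC)).
  have -> : \sum_(i < n | (m <= i)%N) a i * (x + (Q i).[y]) = P.[y] + A * x.
    rewrite horner_sum mulr_suml -big_split /=; apply: eq_bigr => i _.
    by rewrite hornerZ; ring.
  rewrite eD -mulrA; congr (_ * _); rewrite mulrC; congr (_ * _).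
  by apply: eq_bigl => i; rewrite ltnNge.
have X1 : nrm (\avg_ x \avg_ y (e P.[0 * x + 1 * y]
    * \prod_(z <- L) z.1 (x + z.2 * y))) <= 1.
  apply: nrm_avg_le1 => // x; apply: nrm_avg_le1 => // y.
  rewrite nrmM_le1 ?e1 // big_seq; apply: nrm_prod_le1 => z zL.
  by have [z1 _] := LP z zL; apply: z1.
rewrite progE nrmM exprMn; set X := nrm (avg _) in X1 *.
have X0 : 0 <= X := nrm_ge0 _.
apply: (@le_trans _ _ (X ^+ (2 ^ D))).
  rewrite ler_piMl ?exprn_ge0 // expr_le1 ?expn_gt0 ?nrm_ge0 //.
  by apply: nrm_prod_le1 => i mi; have [] := fk i mi.
apply: (@le_trans _ _ (X ^+ (2 ^ d.+1))).
  by rewrite ler_wiXn2l // leq_exp2l //; lia.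
have cF' : char_gt d.+1 F by move=> i id; apply: cF; lia.
have eP1 : bdd (fun y => e P.[y]) by move=> y; rewrite e1.
have ctrl : X ^+ (2 ^ d.+1) <= unif d (fun y => e P.[y]).
  rewrite /X; move: eP1 sL LP; clear; move=> eP1; case: L => [|z0 L'] //= [<-] LP.
  exact: (@linear_control R F (fun y => e P.[y]) 0 1 z0 L' eP1 LP).
apply: le_trans ctrl _; apply: le_trans (unif_poly_phase eC cF' dP) _.
by rewrite ler_wpM2r ?invr_ge0 ?ler0n // ler_nat /=; lia.
Qed.

End Progressions.

(** * Decoupling the polynomial terms *)

Section Decoupling.
Variable R : rcfType.
Local Notation C := R[i].
Local Hint Extern 0 (is_true (0 < #|_|)%N) => exact: card_field_gt0 : core.

Lemma unif_conj (F : finFieldType) s (f : F -> C) :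
  unif s (fun x => (f x)^*%C) = unif s f.
Proof.
elim: s f => [|s IHs] f /=; first by rewrite -conj_avg nrm_conj.
apply: eq_avg => h; rewrite -[RHS]IHs; congr unif; apply/funext => x.
by rewrite /mder rmorphM.
Qed.

Definition small_correlations (F : finFieldType) (e : F -> C) (Fy : F -> F -> C)
    (eps : R) :=
  forall t a, a != 0 ->
    nrm (\avg_ x \avg_ y (shift_prod t (Fy y) x * e (a * x))) <= eps.

(** The norm of order one vanishes with the mean, and degree lowering passes
    the bound from each order to the next one. *)
Lemma lowering_chain r : exists p, (0 < p.1)%N /\ forall (F : finFieldType)
    (e : F -> C) (Fy : F -> F -> C) (eps : R),
  additive_char e -> (forall y, bdd (Fy y)) -> 0 <= eps ->
  small_correlations e Fy eps -> \avg_ x \avg_ y Fy y x = 0 ->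
  small eps p (unif r (fun x => \avg_ y Fy y x)).
Proof.
elim: r => [|r [p [p0 IHr]]].
  exists (1, 0)%N; split=> // F e Fy eps _ _ _ _ G0; split; first exact: unif_ge0.
  by rewrite /= expr1 mul0r G0 nrm0 expr0n.
pose n := (2 ^ r * p.1)%N.
exists (2 ^ r.+1 * n, (2 ^ n * (1 + p.2)).+1)%N; split.
  by rewrite muln_gt0 expn_gt0 muln_gt0 expn_gt0.
move=> F e Fy eps eC F1 eps0 Feps G0.
have [X [X0 lowX Xlow]] := degree_lowering eC r F1 Feps.
have U1 : unif r.+1 (fun x => \avg_ y Fy y x) <= 1.
  by apply: unif_le1 => x; apply: nrm_avg_le1 => // y; apply: F1.
have U0 := unif_ge0 r.+1 (fun x => \avg_ y Fy y x).
have [eps1|eps1] := leP eps 1; last first.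
  split=> //; apply: (@le_trans _ _ 1); first by rewrite exprn_ile1.
  by rewrite (le_trans (ltW eps1)) // ler_peMl // ler1n.
have Xs : small eps (n, p.2) X.
  have := small_root (c := 1) X0 _ (IHr F e Fy eps eC F1 eps0 Feps G0).
  by rewrite exp1n !mul1n; apply; rewrite mul1r.
have es : small eps (n, 1)%N (eps ^+ 2).
  split; first exact: sqr_ge0.
  rewrite /= mul1r -exprM ler_iXnr //.
  by rewrite muln_gt0 /= /n muln_gt0 expn_gt0.
have := small_root (c := 1) U0 _ (small_add es Xs).
rewrite mul1r => /(_ _ lowX); rewrite exp1n mul1n /=.
exact: small_weaken.
Qed.

(** Expanding the product gives an average, up to factors of modulus at most one,
    of correlations of [Fy] itself. *)
Lemma small_correlations_center (F : finFieldType) (e : F -> C)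
    (Fy : F -> F -> C) (mu : C) (eps : R) :
  nrm mu <= 1 -> small_correlations e Fy eps ->
  small_correlations e (fun y x => (Fy y x - mu) / 2) eps.
Proof.
move=> mu1 Feps t a a0.
pose H y x := (Fy y x - mu) / 2.
suff gen s : nrm (\avg_ x \avg_ y (shift_prod s (Fy y) x * shift_prod t (H y) x
    * e (a * x))) <= eps.
  have := gen [::]; rewrite /shift_prod.
  by under eq_avg do under eq_avg do rewrite big_nil mul1r.
elim: t s => [|z t IHt] s.
  have := Feps s a a0; rewrite /shift_prod.
  by under [X in _ -> nrm X <= _]eq_avg do
     under eq_avg do rewrite big_nil mulr1.
have -> : \avg_ x \avg_ y (shift_prod s (Fy y) x * shift_prod (z :: t) (H y) x
      * e (a * x))
    = 2^-1 * (\avg_ x \avg_ y (shift_prod (z :: s) (Fy y) x * shift_prod t (H y) x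
      * e (a * x)) - cj z.1 mu * \avg_ x \avg_ y (shift_prod s (Fy y) x
      * shift_prod t (H y) x * e (a * x))).
  rewrite -avgMl -avgB -avgMl; apply: eq_avg => x.
  rewrite -avgMl -avgB -avgMl; apply: eq_avg => y.
  rewrite /shift_prod !big_cons.
  have -> : cj z.1 (H y (x + z.2)) = 2^-1 * (cj z.1 (Fy y (x + z.2)) - cj z.1 mu).
    rewrite /H mulrC; case: z.1 => //=.
    by rewrite rmorphM rmorphB fmorphV rmorph_nat.
  by ring.
rewrite nrmM nrm_half ler_pdivrMl ?ltr0n //.
apply: le_trans (nrmB _ _) _; rewrite mulr_natl mulr2n lerD //.
rewrite nrmM nrm_cj; apply: le_trans (IHt s).
by rewrite ler_piMl ?nrm_ge0.
Qed.

Lemma shift_prod_char (F : finFieldType) (e f : F -> C) k a t :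
    additive_char e -> nrm k <= 1 -> (forall x, f x = k * e (a * x)) ->
  exists u : C * F, nrm u.1 <= 1 /\
    forall x, shift_prod t f x = u.1 * e (u.2 * x).
Proof.
move=> eC k1 fE; have [eD e1 _] := eC; rewrite /shift_prod.
elim: t => [|z t [u [u1 uE]]].
  exists (1, 0); split=> [|x]; first by rewrite nrm1.
  by rewrite big_nil mul0r (char0 eC) mulr1.
exists (cj z.1 (k * e (a * z.2)) * u.1, (if z.1 then - a else a) + u.2); split=> [|x].
  by rewrite nrmM_le1 // nrm_cj nrmM_le1 ?e1.
have cje : cj z.1 (e (a * x)) = e ((if z.1 then - a else a) * x).
  by case: z.1; rewrite //= mulNr (charN eC).
rewrite big_cons uE fE mulrDl eD -cje mulrDr eD [k * _]mulrCA !cjM /=.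
ring.
Qed.

Definition upd (F : finFieldType) n (f : 'I_n -> F -> C) (l : 'I_n) (g : F -> C) :=
  fun i => if i == l then g else f i.

Lemma bdd_upd (F : finFieldType) n (f : 'I_n -> F -> C) l g :
  (forall i, bdd (f i)) -> bdd g -> forall i, bdd (upd f l g i).
Proof. by move=> f1 g1 i; rewrite /upd; case: ifP. Qed.

Definition dual (F : finFieldType) n (Q : 'I_n -> {poly F}) (f : 'I_n -> F -> C)
    (l : 'I_n) (y x : F) :=
  \prod_(i < n | i != l) f i (x + (Q i).[y] - (Q l).[y]).

Lemma prog_upd (F : finFieldType) n (Q : 'I_n -> {poly F}) f l g :
  prog Q (upd f l g) = \avg_ x \avg_ y (g x * dual Q f l y x).
Proof.
rewrite /prog (shear_avg _ (fun y => - (Q l).[y])).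
apply: eq_avg => x; apply: eq_avg => y.
rewrite (bigD1 l) //= /upd eqxx subrK; congr (_ * _).
by apply: eq_bigr => i /negPf->; rewrite addrAC.
Qed.

Definition char_from (F : finFieldType) (e : F -> C) n (f : 'I_n -> F -> C) (s : nat) :=
  forall i : 'I_n, (s <= i)%N -> exists u : C * F, nrm u.1 <= 1 /\
    forall x, f i x = u.1 * e (u.2 * x).

(** Products of translates of the dual function are the dual function of products
    of translates, so their correlation with a character is a count over the
    same system with this character as [l]-th function. *)
Lemma dual_small_correlations (D m n : nat) (l : 'I_n) p (F : finFieldType)
    (e : F -> C) (Q : 'I_n -> {poly F}) (f : 'I_n -> F -> C) (eps : R) :
  chars_small R D m n l p -> (0 < p.1)%N -> 0 <= eps ->
  eps ^+ p.1 = p.2%:R * #|F|%:R^-1 ->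
  good_system D m Q -> additive_char e -> (forall i, bdd (f i)) ->
  char_from e f l.+1 -> small_correlations e (dual Q f l) eps.
Proof.
move=> S p0 eps0 epsE gQ eC f1 fC t a a0; have [eD e1 _] := eC.
pose g := upd (fun i => shift_prod t (f i)) l (fun x => e (a * x)).
have g1 i : bdd (g i).
  apply: bdd_upd => [j|] x; last by rewrite e1.
  by apply: nrm_prod_le1 => z _; rewrite nrm_cj; apply: f1.
pose ok (i : 'I_n) (u : C * F) := (l <= i)%N ->
  [/\ nrm u.1 <= 1, forall x, g i x = u.1 * e (u.2 * x) & i = l -> u.2 = a].
have [u uP] : {u : 'I_n -> C * F & forall i, ok i (u i)}.
  apply: choice => i; rewrite /ok /g /upd; have [->|il] := eqVneq i l.
    by exists (1, a) => _; split=> [|x|//]; rewrite ?nrm1 ?mul1r.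
  have [li|le_il] := ltnP l i; last first.
    exists (1, a) => li; case/eqP: il; apply/val_inj/eqP.
    by rewrite eqn_leq /= le_il.
  have [v [v1 vE]] := fC i li; have [u [u1 uE]] := shift_prod_char t eC v1 vE.
  by exists u => _; split=> // E; rewrite E eqxx in il.
have -> : \avg_ x \avg_ y (shift_prod t (dual Q f l y) x * e (a * x)) = prog Q g.
  rewrite prog_upd; apply: eq_avg => x; apply: eq_avg => y; rewrite mulrC.
  congr (_ * _); rewrite /shift_prod /dual exchange_big /=.
  transitivity (\prod_(z <- t) \prod_(i < n | i != l)
      cj z.1 (f i (x + z.2 + (Q i).[y] - (Q l).[y]))).
    apply: eq_bigr => z _; elim/big_rec2: _ => [|i b c _ <-]; last by rewrite cjM.
    by rewrite /cj conjc1; case: z.1.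
  apply: eq_bigr => z _; apply: eq_bigr => i _.
  by congr (cj _ (f i _)); ring.
have [||N0 le_eps] := S F e Q g (fun i => (u i).1) (fun i => (u i).2) gQ eC g1.
- by move=> i li; have [] := uP i li.
- by exists l => //; have [//|_ _ ->] := uP l _.
rewrite -(@ler_pXn2r _ p.1) ?nnegrE // ?nrm_ge0 //.
by rewrite epsE.
Qed.

End Decoupling.

Section Asymptotics.
Variable R : rcfType.
Local Notation C := R[i].
Local Hint Extern 0 (is_true (0 < #|_|)%N) => exact: card_field_gt0 : core.

Lemma inv_card_gt0 (F : finFieldType) : 0 < #|F|%:R^-1 :> R.
Proof. by rewrite invr_gt0 ltr0n card_field_gt0. Qed.

Lemma inv_card_le1 (F : finFieldType) : #|F|%:R^-1 <= 1 :> R.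
Proof. by rewrite invf_le1 ?ler1n ?ltr0n ?card_field_gt0. Qed.

(** A configuration whose later functions are characters depends on its [l]-th
    function only through the mean of that function.  Control by a uniformity
    norm is applied to the balanced dual function, whose uniformity norms are
    small by degree lowering, the mean being zero. *)
Lemma decouple D m n (l : 'I_n) p : (0 < m <= l)%N ->
    (0 < p.1)%N -> chars_small R D m n l p ->
  exists q, (0 < q.1)%N /\ forall (F : finFieldType) (e : F -> C)
      (Q : 'I_n -> {poly F}) (f : 'I_n -> F -> C),
    good_system D m Q -> additive_char e -> (forall i, bdd (f i)) ->
    char_from e f l.+1 ->
    small #|F|%:R^-1 q
      (nrm (prog Q f - avg (f l) * prog Q (upd f l (fun=> 1))) / 2).
Proof.
move=> /andP[m0 ml] p0 S.
have [N [K [s PET]]] := @target_control R D m n m0.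
have [c cP] := choice (@lowering_chain R).
pose n1 := (\max_(i < s) ((c i).1 * p.1))%N.
pose k1 := (\max_(i < s) ((c i).2 ^ p.1 * p.2))%N.
have [q1 q1P] := @small_sum R n1 k1.+1 s.+1.
pose q2 := (N * q1.1, K ^ q1.1 * q1.2)%N.
pose q3 := (q2.1.+1, q2.2).
exists (2 * q3.1, 1 ^ q3.1 * q3.2)%N; split=> //.
move=> F e Q f gQ eC f1 fC; have [eD e1 _] := eC.
set d : R := #|F|%:R^-1.
have d0 : 0 <= d by apply/ltW/inv_card_gt0.
have d1 : d <= 1 by apply: inv_card_le1.
have [eps eps0 epsE] := exists_root p.1.-1 (mulr_ge0 (ler0n R p.2) d0).
rewrite prednK // in epsE.
pose Fy := dual Q f l; pose G x := \avg_ y Fy y x; pose mu := avg G.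
have F1 y : bdd (Fy y) by move=> x; apply: nrm_prod_le1 => i _; apply: f1.
have G1 : bdd G by move=> x; apply: nrm_avg_le1 => // y; apply: F1.
have mu1 : nrm mu <= 1 by apply: nrm_avg_le1.
pose H y x := (Fy y x - mu) / 2; pose G0 x := \avg_ y H y x.
have H1 y : bdd (H y).
  move=> x; rewrite nrmM nrm_half ler_pdivrMr ?ltr0n // mul1r.
  by apply: le_trans (nrmB _ _) _; rewrite mulr2n lerD //; apply: F1.
have G0E x : G0 x = (G x - mu) / 2 by rewrite /G0 avgMr avgB avg_cst.
have G0_mean : avg G0 = 0.
  under eq_avg do rewrite G0E.
  by rewrite avgMr avgB avg_cst // subrr mul0r.
have G01 : bdd G0 by move=> x; apply: nrm_avg_le1 => // y; apply: H1.
have Heps : small_correlations e H eps.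
  apply: small_correlations_center mu1 _.
  exact: (dual_small_correlations S p0 eps0 epsE gQ eC f1 fC).
have smallU : small d q1 (\sum_(i < s) unif i G0 + d).
  pose a i := if (i < s)%N then unif i G0 else d.
  have -> : \sum_(i < s) unif i G0 + d = \sum_(i < s.+1) a i.
    rewrite big_ord_recr /= /a ltnn; congr (_ + _).
    by apply: eq_bigr => i _; rewrite ltn_ord.
  apply: q1P => // i; rewrite /a ltnS leq_eqVlt; case: ltnP => [si _|si].
    have [c0 /(_ F e H eps eC H1 eps0 Heps G0_mean) ci] := cP i.
    have eps_small : small d p eps by split=> //; rewrite epsE.
    have [u0 ui] := ci; have := small_root u0 ui eps_small.
    apply: small_weaken => //=; first exact: unif_le1.
      by rewrite ltnW // ltnS (leq_bigmax (Ordinal si)).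
    by rewrite ltnW // ltnS (leq_bigmax (Ordinal si)).
  move=> _; split=> //; apply: (@le_trans _ _ d); first by rewrite ler_iXnr.
  by rewrite ler_peMl // ler1n.
pose f' := upd f l (fun x => (G0 x)^*%C).
have f'1 i : bdd (f' i).
  by apply: bdd_upd => // x; rewrite nrm_conj.
have small3 : small d q3 (nrm (prog Q f')).
  apply: (@small_weaken _ _ q2) => //; first exact: nrm_prog_le1.
  have := PET F Q f' l gQ ml f'1; rewrite {2}/f' /upd eqxx.
  under eq_bigr do rewrite unif_conj.
  by move=> le; apply: small_root (nrm_ge0 _) le smallU.
have G0_energy : \avg_ x nrm (G0 x) ^+ 2 <= nrm (prog Q f').
  have E0 : 0 <= \avg_ x nrm (G0 x) ^+ 2 by apply: avg_ge0 => x; apply: sqr_ge0.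
  rewrite -[leLHS]nrmR // real_avg.
  have -> : \avg_ x (nrm (G0 x) ^+ 2)%:C%C = 2^-1 * prog Q f' :> C.
    rewrite prog_upd; transitivity (\avg_ x (2^-1 * ((G0 x)^*%C * G x) -
        (2^-1 * mu) * (G0 x)^*%C)).
      by apply: eq_avg => x; rewrite -mul_conj {1}G0E; ring.
    rewrite avgB avgMl [X in _ - X]avgMl -conj_avg G0_mean conjc0 mulr0 subr0.
    by congr (_ * _); apply: eq_avg => x; rewrite avgMl.
  rewrite nrmM nrm_half ler_piMl ?nrm_ge0 // invf_le1 ?ltr0n // ler1n.
  by [].
have diffE : prog Q f - avg (f l) * prog Q (upd f l (fun=> 1))
    = 2 * \avg_ x (f l x * G0 x).
  have -> : prog Q (upd f l (fun=> 1)) = mu.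
    rewrite prog_upd; apply: eq_avg => x; apply: eq_avg => y.
    by rewrite mul1r.
  have -> : prog Q f = prog Q (upd f l (f l)).
    congr prog; apply/funext => i; rewrite /upd.
    by case: eqVneq => [->|].
  rewrite prog_upd -avgMr -avgB -avgMl; apply: eq_avg => x.
  by rewrite avgMl -[avg _]/(G x) G0E; field.
have X0 : 0 <= nrm (prog Q f - avg (f l) * prog Q (upd f l (fun=> 1))) / 2.
  by rewrite divr_ge0 ?nrm_ge0 ?ler0n.
apply: small_root X0 _ small3; rewrite mul1r; apply: le_trans _ G0_energy.
have n2 : nrm (2 : C) = 2.
  have -> : (2 : C) = (2 : R)%:C%C by rewrite rmorph_nat.
  by rewrite nrmR ?ler0n.
rewrite diffE nrmM n2 mulrAC divff ?mul1r ?pnatr_eq0 //.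
exact: (avg_weight_sqr G0 (card_field_gt0 F) (f1 l)).
Qed.

Lemma half_le1 (z w : C) : nrm z <= 1 -> nrm w <= 1 -> nrm (z - w) / 2 <= 1.
Proof.
move=> z1 w1; rewrite ler_pdivrMr ?ltr0n // mul1r.
by apply: le_trans (nrmB _ _) _; rewrite mulr2n lerD.
Qed.

(** Once the function [l] is decoupled it may be replaced by the constant one,
    a trivial character, which brings the number of non-characters down. *)
Lemma prog_some_character D m n s : (0 < m <= s)%N -> (s <= n)%N ->
  exists p, (0 < p.1)%N /\ chars_small R D m n s p.
Proof.
move=> /andP[m0 ms]; rewrite -(subnKC ms); elim: (s - m)%N => {s ms} [|j IHj] sn.
  by rewrite addn0; apply: prog_characters.
have sn' : (m + j < n)%N by rewrite -addnS.
have [p [p0 S]] := IHj (ltnW sn'); pose l : 'I_n := Ordinal sn'.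
have ml : (0 < m <= l)%N by rewrite m0 leq_addr.
have [q [q0 DC]] := decouple ml p0 S.
exists (1 * (q.1 + p.1), 2 ^ (q.1 + p.1) * (2 ^ (q.1 + p.1) * (q.2 + p.2)))%N.
split=> [|F e Q f k a gQ eC f1 fk [i0 mi0 ai0]]; first by rewrite mul1n addn_gt0 q0.
have d0 := ltW (inv_card_gt0 F).
have fC : char_from e f l.+1.
  by move=> i li; exists (k i, a i); apply: fk; rewrite addnS.
pose g := upd f l (fun=> 1).
have g1 i : bdd (g i) by apply: bdd_upd => // x; rewrite nrm1.
have smallD := DC F e Q f gQ eC f1 fC.
have smallg : small #|F|%:R^-1 p (nrm (prog Q g)).
  pose k' i := if i == l then 1 else k i.
  pose a' i := if i == l then 0 else a i.
  apply: (S F e Q g k' a') => //.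
    move=> i li; rewrite /g /upd /k' /a'; case: eqVneq => [_|il].
      by split=> [|x]; rewrite ?nrm1 // mul0r (char0 eC) mulr1.
    apply: fk; rewrite addnS ltn_neqAle li andbT; apply: contra il => /eqP E.
    by apply/eqP/val_inj; rewrite /= E.
  exists i0; first by rewrite (leq_trans _ mi0) // addnS.
  rewrite /a'; case: (eqVneq i0 l) => // E.
  by move: mi0; rewrite E /= addnS ltnn.
set X := nrm (prog Q f); have X0 : 0 <= X := nrm_ge0 _.
have avg1 : nrm (avg (f l)) <= 1 by apply: nrm_avg_le1 => //; apply: f1.
have prog1 := nrm_prog_le1 Q f1; have progg1 := nrm_prog_le1 Q g1.
have Xle : X <= nrm (prog Q f - avg (f l) * prog Q g) + nrm (prog Q g).
  rewrite /X -{1}[prog Q f](subrK (avg (f l) * prog Q g)).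
  apply: le_trans (nrmD _ _) _; rewrite lerD2l nrmM.
  by rewrite ler_piMl ?nrm_ge0.
apply: small_root X0 _ (small_add (small_weaken d0 _ _ _ smallD)
                                   (small_weaken d0 _ _ _ smallg)).
- rewrite expr1 mulrDr mulrC divfK ?pnatr_eq0 //; apply: le_trans Xle _.
  by rewrite lerD2l ler_peMl ?nrm_ge0 // ler1n.
- by apply: half_le1; rewrite // nrmM_le1.
- by rewrite /= leq_addr.
- by [].
- by [].
- by rewrite /= leq_addl.
- by [].
Qed.

Definition truncate (F : finFieldType) n (s : nat) (f : 'I_n -> F -> C) : 'I_n -> F -> C :=
  fun i => if (s <= i)%N then fun=> 1 else f i.

(** The polynomial terms of a progression behave independently of the linear
    ones and of each other. *)
Lemma prog_asymptotics D m n : (0 < m <= n)%N ->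
  exists q, (0 < q.1)%N /\ forall (F : finFieldType) (e : F -> C)
      (Q : 'I_n -> {poly F}) (f : 'I_n -> F -> C),
    good_system D m Q -> additive_char e -> (forall i, bdd (f i)) ->
    small #|F|%:R^-1 q (nrm (prog Q f
      - (\prod_(i < n | (m <= i)%N) avg (f i)) * prog Q (truncate m f)) / 2).
Proof.
move=> /andP[m0 mn].
suff gen j : (j <= n - m)%N -> exists q, (0 < q.1)%N /\ forall (F : finFieldType)
    (e : F -> C) (Q : 'I_n -> {poly F}) (f : 'I_n -> F -> C),
    good_system D m Q -> additive_char e -> (forall i, bdd (f i)) ->
    small #|F|%:R^-1 q (nrm (prog Q f
      - (\prod_(i < n | (n - j <= i)%N) avg (f i)) * prog Q (truncate (n - j) f)) / 2).
  have [q [q0 H]] := gen _ (leqnn _); exists q; split=> // F e Q f gQ eC f1.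
  by have := H F e Q f gQ eC f1; rewrite subKn.
elim: j => [|j IHj] jn.
  exists (1, 0)%N; split=> // F e Q f _ _ _; rewrite subn0.
  rewrite big_pred0 => [|i]; last by apply/negbTE; rewrite -ltnNge ltn_ord.
  have -> : truncate n f = f.
    by apply/funext => i; rewrite /truncate leqNgt ltn_ord.
  by rewrite mul1r subrr nrm0 mul0r; split=> //=; rewrite expr1 mul0r.
have [q1 [q10 H1]] := IHj (ltnW jn).
have sn : (n - j.+1 < n)%N by lia.
pose l : 'I_n := Ordinal sn; set s := (n - j.+1)%N in sn l *.
have sE : (n - j)%N = s.+1 by rewrite /s; lia.
have ml : (0 < m <= l)%N by rewrite m0 /= /s; lia.
have [p [p0 S]] : exists p, (0 < p.1)%N /\ chars_small R D m n l p.
  by apply: prog_some_character => //; apply: ltnW.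
have [q2 [q20 H2]] := decouple ml p0 S.
have [r [r0 Hr]] : exists r, (0 < r.1)%N /\ forall (d X Y Z : R),
  0 <= d -> X <= 1 -> Y <= 1 -> 0 <= Z -> Z <= X + Y ->
  small d q1 X -> small d q2 Y -> small d r Z.
  pose N := (q1.1 + q2.1)%N; exists (N, 2 ^ N * (q1.2 + q2.2))%N.
  split=> [|d X Y Z d0 X1 Y1 Z0 ZXY pX qY]; first by rewrite /= /N addn_gt0 q10.
  apply: small_le Z0 ZXY _; apply: small_add.
    by apply: (@small_weaken _ _ q1) => //=; rewrite leq_addr.
  by apply: (@small_weaken _ _ q2) => //=; rewrite leq_addl.
exists r; split=> // F e Q f gQ eC f1.
pose g := truncate s.+1 f.
have g1 i : bdd (g i) by rewrite /g /truncate; case: ifP => // _ x; rewrite nrm1.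
have gC : char_from e g l.+1.
  move=> i si; exists (1, 0); split=> [|x]; first by rewrite nrm1.
  by rewrite /g /truncate ifT // mul0r (char0 eC) mulr1.
have trE : upd g l (fun=> 1) = truncate s f.
  apply/funext => i; rewrite /upd /g /truncate -val_eqE /=.
  by case: (ltngtP s i).
have glE : g l = f l by rewrite /g /truncate ifF // ltnn.
have tr1 i : bdd (truncate s f i).
  by rewrite /truncate; case: ifP => // _ x; rewrite nrm1.
have := H2 F e Q g gQ eC g1 gC; rewrite trE glE => small2.
have := H1 F e Q f gQ eC f1; rewrite sE => small1.
have avg1 i : nrm (avg (f i)) <= 1 by apply: nrm_avg_le1 => //; apply: f1.
have prod1 k : nrm (\prod_(i < n | (k <= i)%N) avg (f i)) <= 1.
  by apply: nrm_prod_le1.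
apply: Hr small1 small2.
- exact/ltW/inv_card_gt0.
- by apply: half_le1; [|apply: nrmM_le1 => //]; apply: nrm_prog_le1.
- by apply: half_le1; [|apply: nrmM_le1 => //]; apply: nrm_prog_le1.
- by rewrite divr_ge0 ?nrm_ge0 ?ler0n.
rewrite -mulrDl ler_wpM2r ?invr_ge0 ?ler0n //.
have -> : prog Q f - (\prod_(i < n | (s <= i)%N) avg (f i)) * prog Q (truncate s f)
  = (prog Q f - (\prod_(i < n | (s < i)%N) avg (f i)) * prog Q g)
    + (\prod_(i < n | (s < i)%N) avg (f i))
      * (prog Q g - avg (f l) * prog Q (truncate s f)).
  have -> : \prod_(i < n | (s <= i)%N) avg (f i)
      = avg (f l) * \prod_(i < n | (s < i)%N) avg (f i).
    rewrite (bigD1 l) //=; congr (_ * _); apply: eq_bigl => i.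
    by rewrite ltn_neqAle andbC -val_eqE /= eq_sym.
  by ring.
apply: le_trans (nrmD _ _) _; rewrite lerD2l nrmM ler_piMl ?nrm_ge0 //.
Qed.

End Asymptotics.

(** * Prime fields *)

Section PrimeFields.
Variable R : rcfType.
Local Notation C := R[i].

Lemma Fp_nat_neq0 p i : prime p -> (0 < i < p)%N -> i%:R != 0 :> 'F_p.
Proof.
move=> pp /andP[i0 ip]; rewrite -(dvdn_pcharf (pchar_Fp pp)).
by rewrite gtnNdvd.
Qed.

Lemma exists_additive_char p : prime p -> exists e : 'F_p -> C, additive_char e.
Proof.
move=> pp; have p1 := prime_gt1 pp; have p0 := prime_gt0 pp.
pose P : {poly C} := \sum_(i < p) 'X^i.
have [z Pz] : exists z, root P z.
  apply/closed_rootP; rewrite /P.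
  have -> : \sum_(i < p) 'X^i = \poly_(i < p) (1 : C).
    by rewrite poly_def; apply: eq_bigr => i _; rewrite scale1r.
  by rewrite size_poly_eq ?oner_eq0 // gtn_eqF.
have Pz0 : \sum_(i < p) z ^+ i = 0.
  by move/eqP: Pz; rewrite /P horner_sum; under eq_bigr do rewrite hornerXn.
have zp : z ^+ p = 1.
  by apply/eqP; rewrite -subr_eq0 subrX1 Pz0 mulr0.
have z1 : z != 1.
  apply: contra_eq_neq Pz0 => ->; under eq_bigr do rewrite expr1n.
  by rewrite sumr_const card_ord pnatr_eq0 -lt0n.
have nz : nrm z = 1.
  by apply/eqP; rewrite -(@pexpr_eq1 _ _ p) ?nrm_ge0 // -nrmX zp nrm1.
pose e (x : 'F_p) : C := z ^+ (x : nat).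
have eD a b : e (a + b) = e a * e b.
  have zq : z ^+ (Zp_trunc (pdiv p)).+2 = 1 by rewrite Fp_cast.
  by rewrite /e -exprD -(expr_mod (a + b)%N zq).
exists e; split=> // [a|]; first by rewrite nrmX nz expr1n.
have e1 : e 1 != 1 by rewrite /e /= modn_small ?expr1 // Fp_cast.
apply/eqP; have := subrr (avg e); rewrite {1}(reindex_avg _ (@addrI _ 1)).
rewrite (_ : avg (e \o _) = e 1 * avg e); last first.
  by rewrite -avgMl; apply: eq_avg => x /=.
by rewrite -{2}[avg e]mul1r -mulrBl => /eqP; rewrite mulf_eq0 subr_eq0 (negPf e1).
Qed.

(** Independence over the reals is the nonvanishing of an integral minor, and
    persists modulo every prime larger than this minor. *)
Lemma independent_mod_p (m k : nat) (P : 'I_k -> {poly int}) :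
    (forall a : 'I_k -> R, (exists j : 'I_k, a j != 0) ->
      (m < size (\sum_(j < k) a j *: map_poly (intr : int -> R) (P j))%R)%N) ->
  exists B : nat, forall p, prime p -> (B < p)%N ->
    forall a : 'I_k -> 'F_p, (exists j : 'I_k, a j != 0) ->
      (m < size (\sum_(j < k) a j *: map_poly (intr : int -> 'F_p) (P j))%R)%N.
Proof.
move=> hP; pose T := (\max_(j < k) size (P j))%N.
pose M : 'M[int]_(k, T) := \matrix_(j, t) (P j)`_(m + t).
have coefE (A : fieldType) (a : 'I_k -> A) i :
    (\sum_(j < k) a j *: map_poly (intr : int -> A) (P j))`_i
    = \sum_(j < k) a j * ((P j)`_i)%:~R.
  by rewrite coef_sum; apply: eq_bigr => j _; rewrite coefZ coef_map.
pose MR := map_mx (intr : int -> R) M.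
have freeM : row_free MR.
  apply: inj_row_free => v vM; apply/rowP => j; rewrite mxE.
  apply/eqP; apply: contraT => vj.
  have := hP (fun j => v 0 j) (ex_intro _ j vj); rewrite ltnNge => /negP[].
  apply/leq_sizeP => i mi; rewrite coefE.
  have [iT|Ti] := ltnP (i - m) T.
    have /rowP/(_ (Ordinal iT)) := vM; rewrite !mxE => vt; rewrite -[RHS]vt.
    by apply: eq_bigr => l _; rewrite !mxE /= subnKC.
  rewrite big1 // => l _; rewrite nth_default ?mulr0 //.
  by rewrite (leq_trans _ (leq_trans Ti (leq_subr m i))) // (leq_bigmax l).
have fullM : row_full MR^T by rewrite /row_full mxrank_tr.
pose f := fullrankfun fullM.
pose S : 'M[int]_k := rowsub f M^T.
have detS : \det S != 0.
  have : \det (map_mx (intr : int -> R) S) != 0.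
    have -> : map_mx (intr : int -> R) S = rowsub f MR^T.
      by apply/matrixP => i j; rewrite !mxE.
    by rewrite -unitfE -unitmxE -row_full_unit; apply: fullrowsub_full.
  by apply: contra_neq => S0; rewrite det_map_mx /= S0.
exists `|\det S|%N => p pp Bp a [j aj]; rewrite ltnNge; apply/negP => /leq_sizeP sa.
have detSp : \det (map_mx (intr : int -> 'F_p) S) != 0.
  rewrite det_map_mx /=; have := Fp_nat_neq0 pp (_ : 0 < `|\det S| < p)%N.
  rewrite absz_gt0 detS Bp => /(_ isT); apply: contra_neq => d0.
  by case: (intP (\det S)) d0 => //= n; rewrite ?abszN /= ?mulrNz // => /eqP; rewrite ?oppr_eq0 => /eqP.
have /row_freeP[V SV] : row_free (map_mx (intr : int -> 'F_p) S)^T.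
  by rewrite row_free_unit unitmx_tr unitmxE unitfE.
case/eqP: aj; pose v : 'rV['F_p]_k := \row_j a j.
suff v0 : v *m (map_mx (intr : int -> 'F_p) S)^T = 0.
  have := congr1 (mulmx^~ V) v0; rewrite /= -mulmxA SV mulmx1 mul0mx.
  by move=> /rowP/(_ j); rewrite !mxE.
apply/rowP => i; rewrite !mxE; have := sa (m + f i)%N (leq_addr _ _).
rewrite coefE => sa0; rewrite -[RHS]sa0; apply: eq_bigr => l _.
by rewrite !mxE.
Qed.

End PrimeFields.

(** * Primes in short intervals *)

(** In Legendre's formula each power of [p] contributes zero or one, and those
    above [2 * n] contribute zero. *)
Lemma logn_central_bin p n : prime p -> (0 < n)%N ->
  (p ^ logn p 'C(2 * n, n) <= 2 * n)%N.
Proof.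
move=> pp n0; have p1 := prime_gt1 pp.
apply: leq_trans (trunc_logP p1 (_ : 0 < 2 * n)%N); last by rewrite muln_gt0.
rewrite leq_exp2l //.
have n2 : (n <= 2 * n)%N by rewrite leq_pmull.
have logE : (logn p 'C(2 * n, n) + 2 * \sum_(1 <= i < (2 * n).+1) n %/ p ^ i
     = \sum_(1 <= i < (2 * n).+1) (2 * n) %/ p ^ i)%N.
  have nE : logn p n`! = (\sum_(1 <= i < (2 * n).+1) n %/ p ^ i)%N.
    rewrite logn_fact // [RHS](@big_cat_nat _ _ _ n.+1) //=.
    have -> : (\sum_(n.+1 <= i < (2 * n).+1) n %/ p ^ i = 0)%N.
      rewrite big_nat_cond big1 // => i; rewrite andbT => /andP[ni _].
      by rewrite divn_small // (leq_trans ni) // ltnW // ltn_expl.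
    by rewrite addn0.
  rewrite -nE -(logn_fact _ pp) -(bin_fact n2) lognM ?muln_gt0 ?fact_gt0 ?bin_gt0 //.
  have -> : (2 * n - n = n)%N by lia.
  by rewrite lognM ?fact_gt0 //; lia.
have : (logn p 'C(2 * n, n) <= \sum_(1 <= i < (2 * n).+1) (p ^ i <= 2 * n))%N.
  rewrite -(leq_add2r (2 * \sum_(1 <= i < (2 * n).+1) n %/ p ^ i)) logE.
  rewrite big_distrr -big_split /=; apply: leq_sum => i _.
  have pi0 : (0 < p ^ i)%N by rewrite expn_gt0 prime_gt0.
  have := divn_eq n (p ^ i); have := ltn_pmod n pi0.
  have := divn_eq (2 * n) (p ^ i); have := ltn_pmod (2 * n) pi0.
  case: (leqP (p ^ i) (2 * n)) => [_|lt2n]; last by rewrite [(2 * n %/ _)%N]divn_small.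
  move: (p ^ i)%N ((2 * n) %/ _)%N ((2 * n) %% _)%N (n %/ _)%N (n %% _)%N pi0 => *.
  nia.
move/leq_trans; apply.
rewrite (@leq_trans (\sum_(1 <= i < (2 * n).+1 | (i < (trunc_log p (2 * n)).+1)%N) 1)) //.
  rewrite [leqRHS]big_mkcond; apply: leq_sum => i _; case: (leqP (p ^ i) (2 * n)) => // le.
  by rewrite ltnS trunc_log_max.
rewrite sum1_count; set t := trunc_log _ _.
rewrite -size_filter -[leqRHS](size_iota 1 t); apply: uniq_leq_size.
  by rewrite filter_uniq // iota_uniq.
by move=> i; rewrite mem_filter mem_index_iota mem_iota add1n => /andP[-> /andP[-> _]].
Qed.

Lemma central_bin_ge n : (2 ^ n <= 'C(2 * n, n))%N.
Proof.
elim: n => [|n IHn]; first by rewrite bin0.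
have -> : (2 * n.+1 = (2 * n).+2)%N by rewrite mulnS.
rewrite binS expnS mul2n -addnn leq_add //; apply: leq_trans IHn _.
  by rewrite binS leq_addl.
exact: leq_bin2l.
Qed.

(** A central binomial coefficient is large, while each prime contributes at
    most [2 * n] to it; so it needs many primes. *)
Lemma exists_prime_quadratic X : exists q, [/\ prime q, (X < q)%N & (q <= 8 * X.+1 ^ 2)%N].
Proof.
pose n := (4 * X.+1 ^ 2)%N; have n0 : (0 < n)%N by rewrite muln_gt0 expn_gt0.
have [/hasP[q qP /and3P[pq Xq qn]]|/hasPn none] :=
    boolP (has (fun q => [&& prime q, (X < q)%N & (q <= 2 * n)%N]) (iota 0 (2 * n).+1)).
  by exists q; split=> //; rewrite (leq_trans qn) // /n mulnA.
pose c := 'C(2 * n, n); have c0 : (0 < c)%N by rewrite bin_gt0 leq_pmull.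
have small_primes p : p \in primes c -> p \in iota 1 X.
  rewrite mem_primes => /and3P[pp _ pc]; rewrite mem_iota prime_gt0 //= add1n ltnS.
  have p2n : (p <= 2 * n)%N.
    have : (p %| (2 * n)`!)%N by rewrite -(@bin_fact _ n) ?leq_pmull // dvdn_mulr.
    elim: (2 * n)%N => [|j IHj]; first by rewrite dvdn1 => /eqP E; rewrite E in pp.
    rewrite factS Euclid_dvdM // => /orP[/dvdn_leq->//|/IHj]; exact: leqW.
  rewrite leqNgt; apply/negP => Xp; have := none p.
  by rewrite mem_iota ltnS p2n pp Xp => /(_ isT).
have c_le : (c <= (2 * n) ^ X)%N.
  rewrite [c]prod_prime_decomp // prime_decompE big_map /=.
  apply: (@leq_trans (\prod_(p <- primes c) (2 * n))).
    rewrite !big_seq; apply: leq_prod => p; rewrite mem_primes => /and3P[pp _ _].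
    exact: logn_central_bin.
  rewrite big_const_seq count_predT iter_muln_1 leq_exp2l; last first.
    by rewrite mul2n -addnn (leq_add n0 n0).
  rewrite -[leqRHS](size_iota 1 X); apply: uniq_leq_size => //; exact: primes_uniq.
have X2 : (X.+1 <= 2 ^ X)%N by apply: ltn_expl.
have : (2 ^ n <= 2 ^ ((3 + 2 * X) * X))%N.
  apply: leq_trans (central_bin_ge n) (leq_trans c_le _).
  rewrite expnM; case: (posnP X) => [->|X0]; first by rewrite !expn0.
  rewrite leq_exp2r // expnD [(2 * X)%N]mulnC expnM /n mulnA leq_mul //.
  by rewrite leq_exp2r.
rewrite leq_exp2l // /n expnS expn1; nia.
Qed.

(** * Supersaturation *)

(** The sum of two elements of the first half of the residues modulo [q] does not
    wrap around, so equal differences modulo [q] are equal as integers, and a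
    progression modulo [q] lying in this half is one of integers. *)
Lemma ap_in_half_interval (m q : nat) (B : {set 'I_(uphalf q)}) :
    (1 < m)%N -> prime q -> (r_ap m q < #|B|)%N ->
  exists a b : 'I_(uphalf q), a != b /\
    forall j, (j < m)%N -> exists2 c, c \in B &
      (c : nat)%:Z = (a : nat)%:Z + j%:Z * ((b : nat)%:Z - (a : nat)%:Z).
Proof.
move=> m1 pq rB; set L := uphalf q in B rB *.
have half i : (i < L)%N -> (2 * i < q)%N by rewrite /L; lia.
have Lq i : (i < L)%N -> (i < q)%N by move/half; lia.
have val_nat i : (i < L)%N -> (i%:R : 'F_q) = i :> nat.
  by move=> /Lq iq; rewrite val_Fp_nat // modn_small.
pose g (i : 'I_L) : 'F_q := (i : nat)%:R.
have g_inj : injective g.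
  move=> i j /(congr1 (fun x : 'F_q => x : nat)); rewrite /g !val_nat //.
  exact: ord_inj.
have : has_ap m (g @: B).
  apply: contraTT rB => noap; rewrite -leqNgt -(card_imset _ g_inj).
  exact: (@leq_bigmax_cond _ (fun A => ~~ has_ap m A) (fun A => #|A|%N)).
case/existsP => x /existsP[y /andP[y0 /forallP apP]].
have cP j : (j < m)%N -> exists2 c : 'I_L, c \in B & g c = x + y *+ j.
  by move=> jm; have /imsetP[c cB cE] := apP (Ordinal jm); exists c.
have [a aB aE] := cP 0%N (ltnW m1); have [b bB bE] := cP 1%N m1.
rewrite mulr0n addr0 in aE; rewrite mulr1n in bE.
exists a, b; split.
  apply: contra_neq y0 => ab; move: bE; rewrite -ab aE => /eqP.
  by rewrite -{1}[x]addr0 => /eqP/addrI.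
have apZ j : (j < m)%N -> exists c, [/\ c \in B, g c = x + y *+ j &
    (c : nat)%:Z = (a : nat)%:Z + j%:Z * ((b : nat)%:Z - (a : nat)%:Z)].
  elim: j => [_|j IHj jm]; first by exists a; rewrite aE mulr0n addr0 mul0r addr0.
  have [c [cB cE cZ]] := IHj (ltnW jm); have [d dB dE] := cP _ jm.
  exists d; split=> //; suff dacb : (d + a = c + b)%N by lia.
  have /(congr1 (fun x : 'F_q => x : nat)) : (d + a)%:R = (c + b)%:R :> 'F_q.
    by rewrite !natrD -/(g d) -/(g a) -/(g c) -/(g b) dE aE cE bE mulrS; ring.
  rewrite !val_Fp_nat // !modn_small //.
    by have := half _ (ltn_ord c); have := half _ (ltn_ord b); lia.
  by have := half _ (ltn_ord d); have := half _ (ltn_ord a); lia.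
by move=> j /apZ[c [cB _ cZ]]; exists c.
Qed.

Section Supersaturation.
Variables (m q : nat) (F : finFieldType).
Hypotheses (m1 : (1 < m)%N) (pq : prime q).
Hypothesis natF_inj : forall i j, (i < uphalf q)%N -> (j < uphalf q)%N ->
  i%:R = j%:R :> F -> i = j.
Implicit Types (A : {set F}) (z : F * F).

Definition ap_set A : {set F * F} :=
  [set z | (z.2 != 0) && [forall i : 'I_m, z.1 + z.2 *+ i \in A]].

(** An arithmetic progression of length [uphalf q] on which [A] has more than
    [r_ap m q] points contains an [m]-term progression lying in [A], and the
    latter arises in this way at most [uphalf q ^ 2] times. *)
Lemma supersaturation A :
  (#|F|.-1 * uphalf q * #|A|
     <= uphalf q ^ 3 * #|ap_set A| + #|F| * #|F|.-1 * r_ap m q)%N.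
Proof.
set L := uphalf q.
pose B z : {set 'I_L} := [set i : 'I_L | z.1 + z.2 *+ i \in A].
(* The progression found at the positions [a] and [b] of the one given by [z]. *)
pose h (a b : 'I_L) z := (z.1 + z.2 *+ a, z.2 * (b%:R - a%:R)).
have ba0 (a b : 'I_L) : a != b -> b%:R - a%:R != 0 :> F.
  move=> ab; rewrite subr_eq0; apply: contra_neq ab => /natF_inj E.
  by apply/esym/ord_inj/E.
have h_inj (a b : 'I_L) : a != b -> injective (h a b).
  move=> ab [x y] [x' y'] [/= E1 /(mulIf (ba0 _ _ ab)) E2].
  by move: E1; rewrite E2 => /addIr->.
have countB z : z.2 != 0 ->
    (#|B z| <= r_ap m q + L * \sum_(a : 'I_L) \sum_(b : 'I_L | a != b) (h a b z \in ap_set A))%N.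
  move=> z0; have [le|] := leqP #|B z| (r_ap m q); first by rewrite (leq_trans le) ?leq_addr.
  case/(ap_in_half_interval m1 pq) => a [b [ab apP]].
  apply: leq_trans (leq_addl _ _); rewrite (leq_trans (max_card _)) // card_ord.
  rewrite leq_pmulr // (bigD1 a) //= (bigD1 b) //=.
  suff -> : h a b z \in ap_set A by rewrite -!addnA add1n.
  rewrite inE /= mulf_neq0 ?ba0 //=.
  apply/forallP => j; have [c cB cE] := apP j (ltn_ord j).
  move: cB; rewrite inE; congr (_ \in A); rewrite -addrA; congr (_ + _).
  have {}cE : c%:R = a%:R + j%:R * (b%:R - a%:R) :> F.
    by have := congr1 (intr : int -> F) cE; rewrite rmorphD rmorphM rmorphB.
  rewrite -[_ *+ c]mulr_natr cE -[_ *+ a]mulr_natr -[_ *+ j]mulr_natr; ring.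
have pairE (G : F * F -> nat) : (\sum_(z : F * F | z.2 != 0%R) G z
    = \sum_(y : F | y != 0%R) \sum_(x : F) G (x, y))%N.
  rewrite exchange_big /= (pair_big_dep xpredT (fun _ y => y != 0) (fun x y => G (x, y))) /=.
  by apply: eq_bigr => -[].
have card0 : #|[pred y : F | y != 0]| = #|F|.-1 by rewrite -(cardC1 0).
have total : (\sum_(z : F * F | z.2 != 0%R) #|B z| = #|F|.-1 * L * #|A|)%N.
  rewrite pairE -mulnA -card0 -sum_nat_const; apply: eq_bigr => y _.
  transitivity (\sum_(x : F) \sum_(i < L) ((x + y *+ i)%R \in A))%N.
    apply: eq_bigr => x _; rewrite -sum1_card big_mkcond /=.
    by apply: eq_bigr => i _; rewrite inE /=; case: (_ \in A).
  rewrite exchange_big /= -[L in RHS]card_ord -sum_nat_const.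
  apply: eq_bigr => i _; rewrite -sum1_card [RHS]big_mkcond /=.
  rewrite (reindex_inj (@addIr _ (- (y *+ i)))) /=.
  by apply: eq_bigr => x _; rewrite subrK; case: (_ \in A).
rewrite -total; apply: (@leq_trans (\sum_(z : F * F | z.2 != 0%R)
   (r_ap m q + L * \sum_(a : 'I_L) \sum_(b : 'I_L | a != b) (h a b z \in ap_set A)))%N).
  by apply: leq_sum => z; apply: countB.
rewrite big_split /= addnC leq_add //; last first.
  rewrite pairE; under eq_bigr do rewrite sum_nat_const.
  by rewrite sum_nat_const card0 mulnA [(_ * #|_|)%N]mulnC leqnn.
rewrite -big_distrr /= expnS -mulnA leq_mul2l; apply/orP; right.
rewrite exchange_big /=.
apply: (@leq_trans (\sum_(a : 'I_L) \sum_(b : 'I_L) #|ap_set A|)%N); last first.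
  by rewrite !sum_nat_const !card_ord expnS expn1 mulnA.
move: (ap_set A) => S; apply: leq_sum => a _.
rewrite exchange_big /= [leqLHS]big_mkcond /=.
apply: leq_sum => b _; case: ifP => // ab.
apply: (@leq_trans #|[set z | h a b z \in S]|).
  rewrite -sum1_card [leqRHS]big_mkcond [leqLHS]big_mkcond /=.
  apply: leq_sum => z _; rewrite finset.in_set.
  by case: (z.2 != 0); case: (h a b z \in S).
rewrite -(card_imset _ (h_inj a b ab)); apply: subset_leq_card.
by apply/fintype.subsetP => _ /imsetP[z + ->]; rewrite finset.in_set.
Qed.

End Supersaturation.

(** * Counting progressions in a set *)

Section Counting.
Variable R : rcfType.
Local Notation C := R[i].
Local Hint Extern 0 (is_true (0 < #|_|)%N) => exact: card_field_gt0 : core.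
Variables (m k : nat) (P : 'I_k -> {poly int}).
Hypothesis m2 : (2 <= m)%N.

Definition progression_system p (i : 'I_(m + k)) : {poly 'F_p} :=
  match fintype.split i with
  | inl i => (i : nat)%:R *: 'X
  | inr j => map_poly intr (P j)
  end.

Arguments progression_system : clear implicits.

Lemma progression_system_l p (i : 'I_m) :
  progression_system p (lshift k i) = (i : nat)%:R *: 'X.
Proof. by rewrite /progression_system (unsplitK (inl i)). Qed.

Lemma progression_system_r p (j : 'I_k) :
  progression_system p (rshift m j) = map_poly intr (P j).
Proof. by rewrite /progression_system (unsplitK (inr j)). Qed.

Lemma good_progression_system p (D := (m + \max_(j < k) size (P j))%N) :
    prime p -> (D < p)%N ->
    (forall a : 'I_k -> 'F_p, (exists j : 'I_k, a j != 0) ->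
      (m < size (\sum_(j < k) a j *: map_poly (intr : int -> 'F_p) (P j))%R)%N) ->
  good_system D m (progression_system p).
Proof.
move=> pp Dp ind.
have size_lin (c : 'F_p) : (size (c *: 'X)%R <= 2)%N.
  by rewrite (leq_trans (size_scale_leq _ _)) // size_polyX.
have sizeB (j j' : 'I_k) : j' != j -> (m < size (map_poly (intr : int -> 'F_p) (P j)
    - map_poly (intr : int -> 'F_p) (P j'))%R)%N.
  move=> jj'; pose a l : 'F_p := (l == j)%:R - (l == j')%:R.
  have := ind a (ex_intro _ j _); rewrite (bigD1 j) //= (bigD1 j') //= big1 => [|l].
    rewrite /a !eqxx [j == j']eq_sym (negPf jj') subr0 sub0r addr0.
    by rewrite scale1r scaleN1r; apply; rewrite oner_eq0.
  by rewrite /a => /andP[/negPf-> /negPf->]; rewrite subrr scale0r.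
have size1 (j : 'I_k) : (m < size (map_poly (intr : int -> 'F_p) (P j)))%N.
  pose a l : 'F_p := (l == j)%:R.
  have := ind a (ex_intro _ j _); rewrite (bigD1 j) //= big1 => [|l /negPf lj].
    by rewrite /a eqxx scale1r addr0; apply; rewrite oner_eq0.
  by rewrite /a lj scale0r.
split.
- by move=> i /andP[i0 iD]; apply: Fp_nat_neq0; rewrite // i0 (leq_ltn_trans iD).
- move=> i; rewrite /progression_system; case: fintype.split => j.
    by rewrite (leq_trans (size_lin _)) // ltnS (leq_trans (ltnW m2)) // leq_addr.
  rewrite (leq_trans (size_poly _ _)) // (leq_trans _ (leqnSn _)) //.
  by apply: leq_trans (leq_addl m _); apply: (@leq_bigmax _ (fun j => size (P j))).
- move=> i im; rewrite /progression_system; case: splitP => j ij //.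
  by move: im; rewrite ij ltnNge leq_addr.
- move=> i i0; rewrite /progression_system; case: splitP => j ij.
    by rewrite -ij i0 scale0r.
  by move: m2; move: ij; rewrite i0 => /esym/eqP; rewrite addn_eq0 => /andP[/eqP->].
- move=> l i ml il.
  case: (splitP l) il => [j lj|j lj il].
    by move: ml; rewrite lj leqNgt ltn_ord.
  have lE : l = rshift m j by apply: val_inj.
  rewrite lE in il *; rewrite progression_system_r.
  case: (splitP i) => i' ii'.
    have -> : i = lshift k i' by apply: val_inj.
    rewrite progression_system_l size_polyDl.
      by rewrite (leq_trans m2) // ltnW.
    by rewrite size_polyN (leq_ltn_trans (size_lin _)) // (leq_ltn_trans m2).
  have iE : i = rshift m i' by apply: val_inj.
  rewrite iE in il *; rewrite progression_system_r (leq_trans m2) // ltnW // sizeB //.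
  by apply: contra_neq il => ->.
- move=> a [i mi ai].
  have -> : \sum_(i < m + k | (m <= i)%N) a i *: progression_system p i
      = \sum_(j < k) a (rshift m j) *: map_poly (intr : int -> 'F_p) (P j).
    rewrite big_mkcond big_split_ord /= big1 ?add0r => [|j _]; last first.
      by rewrite leqNgt ltn_ord.
    by apply: eq_bigr => j _; rewrite leq_addr progression_system_r.
  apply: ind; case: (splitP i) => j ij; first by move: mi; rewrite ij leqNgt ltn_ord.
  by exists j; rewrite (_ : rshift m j = i) //; apply: val_inj.
Qed.

Lemma prod_indicator (K : comNzRingType) (I : finType) (b : pred I) :
  \prod_i ((b i)%:R : K) = [forall i, b i]%:R.
Proof.
have [/forallP bT|] := boolP [forall i, b i]; first by rewrite big1 // => i _; rewrite bT.
rewrite negb_forall => /existsP[i /negPf bi].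
by rewrite (bigD1 i) //= bi mul0r.
Qed.

(** In a set without polynomial progressions only the pairs with [y = 0] are
    counted, a proportion [1 / p] of all pairs. *)
Lemma count_bound :
    (forall a : 'I_k -> R, (exists j : 'I_k, a j != 0) ->
      (m < size (\sum_(j < k) a j *: map_poly (intr : int -> R) (P j))%R)%N) ->
  exists M K B : nat, (0 < M)%N /\ forall p, prime p -> (B < p)%N ->
    forall A : {set 'F_p}, ~~ has_poly_progression m P A ->
    ((#|A|%:R / p%:R) ^+ k * (#|ap_set m A|%:R / p%:R ^+ 2)) ^+ M <= K%:R / p%:R :> R.
Proof.
move=> hP; have [B0 indB] := independent_mod_p hP.
pose D := (m + \max_(j < k) size (P j))%N.
have [|q [q0 qP]] := @prog_asymptotics R D m (m + k).
  by rewrite leq_addr (ltnW m2).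
exists q.1, (2 ^ q.1 * (2 ^ q.1 * (q.2 + 1)))%N, (maxn B0 D).
split=> // p pp; rewrite gtn_max => /andP[Bp Dp] A noprog.
have gQ := good_progression_system pp Dp (indB p pp Bp).
have [e eC] := exists_additive_char R pp.
pose f (i : 'I_(m + k)) (x : 'F_p) : C := (x \in A)%:R.
have f1 i : bdd (f i).
  by move=> x; rewrite /f; case: (x \in A); rewrite ?nrm1 ?nrm0.
have := qP _ e _ f gQ eC f1.
set Q := progression_system p; set d : R := _^-1; move=> small1.
have cardF : #|'F_p| = p by rewrite card_Fp.
have dE : d = p%:R^-1 by rewrite /d cardF.
have p0 : 0 < p%:R :> R by rewrite ltr0n prime_gt0.
have d0 : 0 <= d by rewrite dE invr_ge0 ltW.
have d1 : d <= 1 by rewrite dE invf_le1 // ler1n prime_gt0.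
have Ql i x y : x + (Q (lshift k i)).[y] = x + y *+ i.
  by rewrite /Q progression_system_l hornerZ hornerX mulr_natl.
have Qr j x y : x + (Q (rshift m j)).[y] = x + (map_poly intr (P j)).[y].
  by rewrite /Q progression_system_r.
have prog_le : nrm (prog Q f) <= d.
  apply: le_trans (nrm_avg _) _; apply: avg_le_cst => // x.
  apply: le_trans (nrm_avg _) _.
  apply: (@le_trans _ _ (\avg_ y ((y == 0 :> 'F_p)%:R : R))); last first.
    rewrite /avg -natr_sum (bigD1 0) //= big1 ?addn0 ?eqxx ?mul1r //.
    by move=> y /negPf->.
  apply: le_avg => y; case: eqVneq => [_|y0].
    by apply: nrm_prod_le1 => i _; apply: f1.
  rewrite prod_indicator (_ : [forall i, _] = false) ?nrm0 //.
  apply/negbTE; apply: contra noprog => /forallP inA.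
  apply/existsP; exists x; apply/existsP; exists y; rewrite y0 /=.
  by apply/andP; split; apply/forallP => i; rewrite -?Ql -?Qr; apply: inA.
have avgE : \prod_(i < m + k | (m <= i)%N) avg (f i) = ((#|A|%:R / p%:R) ^+ k)%:C%C.
  rewrite big_mkcond big_split_ord /= big1 ?mul1r => [|j _]; last first.
    by rewrite leqNgt ltn_ord.
  transitivity (\prod_(j < k) ((#|A|%:R / p%:R : R)%:C%C)).
    apply: eq_bigr => j _; rewrite leq_addr /avg /f -natr_sum cardF.
    rewrite fmorph_div /= !rmorph_nat; congr (_%:R / _).
    rewrite -sum1_card [RHS]big_mkcond /=; by apply: eq_bigr => x _; case: (x \in A).
  by rewrite prodr_const card_ord rmorphXn.
pose t : R := \avg_ x \avg_ y ([forall i : 'I_m, x + y *+ i \in A])%:R.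
have tE : prog Q (truncate m f) = t%:C%C.
  rewrite real_avg; apply: eq_avg => x; rewrite real_avg; apply: eq_avg => y.
  rewrite rmorph_nat -prod_indicator big_split_ord /= [X in _ * X]big1 ?mulr1.
    apply: eq_bigr => i _; rewrite /truncate /= leqNgt ltn_ord /=.
    by rewrite -Ql.
  by move=> j _; rewrite /truncate /= leq_addr.
have t_ge : #|ap_set m A|%:R / p%:R ^+ 2 <= t.
  rewrite expr2 invfM mulrA -dE.
  have -> : #|ap_set m A|%:R * d * d
      = \avg_ x \avg_ y ((x, y) \in ap_set m A)%:R :> R.
    rewrite /avg -mulr_suml -/d; congr (_ * _ * _).
    rewrite pair_bigA /= -natr_sum -sum1_card [in LHS]big_mkcond /=.
    by congr (_%:R); apply: eq_bigr => -[x y] _ /=; case: (_ \in _).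
  apply: le_avg => x; apply: le_avg => y; rewrite inE /= ler_nat.
  by case: (y != 0); case: [forall _, _].
set a : R := (#|A|%:R / p%:R) ^+ k in avgE *.
have a0 : 0 <= a by rewrite exprn_ge0 // divr_ge0 ?ler0n.
rewrite avgE tE in small1.
set X := nrm _ / 2 in small1.
have t0 : 0 <= t by apply: avg_ge0 => x; apply: avg_ge0 => y; rewrite ler0n.
have small2 : small d (q.1, 1%N) d.
  by split=> //=; rewrite mul1r ler_iXnr.
have Z0 : 0 <= a * (#|ap_set m A|%:R / p%:R ^+ 2).
  by rewrite mulr_ge0 // divr_ge0 ?ler0n ?exprn_ge0 ?ltW.
have Zle : (a * (#|ap_set m A|%:R / p%:R ^+ 2)) ^+ 1 <= 2%:R * (X + d).
  rewrite expr1; apply: le_trans (ler_wpM2l a0 t_ge) _.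
  have -> : a * t = nrm (prog Q f - (prog Q f - a%:C%C * t%:C%C)).
    by rewrite opprB addrC subrK nrmM !nrmR.
  apply: le_trans (nrmB _ _) _; rewrite mulrDr [2%:R * X]mulrC divfK ?pnatr_eq0 //.
  rewrite addrC lerD2l; apply: le_trans prog_le _.
  by rewrite ler_peMl // ler1n.
have small1' : small d (q.1, q.2) X by case: q {q0 qP} small1 small2.
have [_] := small_root Z0 Zle (small_add small1' small2).
by rewrite /= mul1n dE.
Qed.

End Counting.

(** * From counting to density *)

Lemma r_ap_gt0 m q : (1 < m)%N -> (0 < r_ap m q)%N.
Proof.
move=> m1; have noap : ~~ has_ap m [set (0 : 'F_q)].
  apply/negP => /existsP[x /existsP[y /andP[y0 /forallP ap]]].
  have := ap (Ordinal (ltnW m1)); rewrite inE mulr0n addr0 => /eqP x0.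
  have := ap (Ordinal m1); rewrite inE mulr1n x0 add0r => /eqP yE.
  by rewrite yE eqxx in y0.
apply: leq_trans (@leq_bigmax_cond _ (fun A => ~~ has_ap m A)
  (fun A => #|A|%N) _ noap).
by rewrite cards1.
Qed.

Lemma dense_set_many_aps m p q (A : {set 'F_p}) :
    (1 < m)%N -> prime p -> prime q -> (q <= p)%N ->
    (4 * p * r_ap m q <= q * #|A|)%N ->
  (p * #|A| <= 4 * q ^ 2 * #|ap_set m A|)%N.
Proof.
move=> m1 pp pq qp dense; have p1 := prime_gt1 pp; have q1 := prime_gt1 pq.
have inj i j : (i < uphalf q)%N -> (j < uphalf q)%N ->
    i%:R = j%:R :> 'F_p -> i = j.
  move=> iL jL /(congr1 (fun x : 'F_p => x : nat)).
  by rewrite !val_Fp_nat // !modn_small //; lia.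
have := supersaturation m1 pq inj A; rewrite card_Fp //.
have L1 : (q <= 2 * uphalf q)%N by lia.
have L2 : (uphalf q <= q)%N by lia.
move: (uphalf q) L1 L2 => L L1 L2; move: #|ap_set m A| => N.
move: (r_ap m q) #|A| dense => r a dense super.
have L0 : (0 < L)%N by lia.
have pr : (2 * p * r <= L * a)%N by nia.
have le1 : (p.-1 * L * a <= 2 * L ^ 3 * N)%N.
  have : (p.-1 * (2 * p * r) <= p.-1 * (L * a))%N by rewrite leq_mul2l pr orbT.
  by nia.
have le2 : (p.-1 * a <= 2 * L ^ 2 * N)%N.
  rewrite -(leq_pmul2l L0); apply: leq_trans (leq_trans _ le1) _; first by lia.
  by rewrite !expnS expn0; lia.
have LL : (L ^ 2 <= q ^ 2)%N by rewrite leq_exp2r.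
apply: (@leq_trans (2 * (p.-1 * a))); first by nia.
by nia.
Qed.

Lemma many_aps_cube p q a N : (p * a <= 4 * q ^ 2 * N)%N -> (4 * p <= q * a)%N ->
  (p ^ 2 <= N * q ^ 3)%N.
Proof.
move=> many A_ge; rewrite -(leq_pmul2l (isT : 0 < 4)%N) expnS expn1 mulnA.
apply: leq_trans (leq_mul A_ge (leqnn p)) _.
rewrite -mulnA [(a * p)%N]mulnC; apply: leq_trans (leq_mul (leqnn q) many) _.
by rewrite !expnS expn0; nia.
Qed.

Local Open Scope classical_set_scope.
Local Open Scope ring_scope.

Theorem theorem2 (R : realType) (m k : nat) (P : 'I_k -> {poly int})
  (hm : (3 <= m)%N) (hk : (1 <= k)%N)
  (hP : forall a : 'I_k -> R, (exists j : 'I_k, a j != 0) ->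
     (m < size (\sum_(j < k) a j *: map_poly (intr : int -> R) (P j))%R)%N) :
  exists c C p1 : R, [/\ 0 < c, 0 < C, 0 < p1 &
    forall (p0 : R) (s : R -> R),
      0 < p0 ->
      (forall x : R, p0 <= x -> 0 < s x <= 1) ->
      (forall x y : R, p0 <= x -> x <= y -> s y <= s x) ->
      s x @[x --> +oo] --> (0 : R) ->
      (forall q : nat, prime q -> p0 <= q%:R ->
         (r_ap m q)%:R <= q%:R * s q%:R) ->
      forall p : nat, prime p -> p1 <= p%:R -> p0 <= c * p%:R `^ c ->
      forall A : {set 'F_p}, ~~ has_poly_progression m P A ->
        #|A|%:R <= C * p%:R * s (c * p%:R `^ c)].
Proof.
have m1 : (1 < m)%N by apply: ltnW.
have [M [K [B [M0 count]]]] := count_bound m1 hP.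
(* The two bounds give [p <= K * q ^ T], while [q = O(p ^ (2 * c))] and
   [2 * c * T = 1 / 2]. *)
pose T := ((k + 3) * M)%N; have T0 : (0 < T)%N by rewrite muln_gt0 addn_gt0 orbT.
pose c : R := (4 * T)%:R^-1.
have T4 : 0 < (4 * T)%:R :> R by rewrite ltr0n muln_gt0.
have c0 : 0 < c by rewrite invr_gt0.
have c1 : c <= 1 by rewrite invf_le1 // ler1n muln_gt0.
pose P1 := (B.+1 + 32 ^ 2 + K ^ 2 * 32 ^ (2 * T) + 1)%N.
have P1_gt0 : 0 < P1%:R :> R by rewrite ltr0n /P1 addn1.
exists c, 4, P1%:R; split=> //.
move=> p0 s p0_gt0 s01 s_dec _ r_le p pp; rewrite ler_nat => P1p p0X A noprog.
(* The decreasing function is evaluated at [X]; the prime [q] is taken just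
   above, so that [s q <= s X]. *)
set X : R := c * p%:R `^ c in p0X *.
pose u : R := p%:R `^ c.
have p_gt0 : 0 < p%:R :> R by rewrite ltr0n prime_gt0.
have uT : u ^+ (4 * T) = p%:R.
  by rewrite -powR_mulrn ?powR_ge0 // /u -powRrM mulVf ?gt_eqF // powRr1 // ltW.
have u0 : 0 <= u by apply: powR_ge0.
have u1 : 1 <= u.
  rewrite leNgt; apply/negP => u_lt1.
  have : u ^+ (4 * T) < 1 by rewrite exprn_ilt1 // muln_eq0 /= -lt0n.
  by rewrite uT ltrn1 ltnNge prime_gt0.
have X0 : 0 <= X by apply: mulr_ge0 => //; apply: ltW.
have Xu : X <= u by rewrite ler_piMl.
have /andP[nX Xn] := truncn_itv X0; set n := Num.truncn X in nX Xn.
have [q [pq nq qn]] := exists_prime_quadratic n.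
have q0 : 0 < q%:R :> R by rewrite ltr0n prime_gt0.
have Xq : X <= q%:R by rewrite (le_trans (ltW Xn)) // ler_nat.
have qu : q%:R <= 32 * u ^+ 2.
  have nu : n.+1%:R <= 2 * u.
    by rewrite -natr1 (le_trans (lerD nX u1)) // mulr_natl mulr2n lerD2r.
  apply: (@le_trans _ _ (8 * (2 * u) ^+ 2)); last by rewrite exprMn; lra.
  apply: (@le_trans _ _ (8 * n.+1 ^ 2)%:R); first by rewrite ler_nat.
  by rewrite natrM natrX ler_wpM2l // lerXn2r ?nnegrE ?ler0n ?mulr_ge0.
have qp : (q <= p)%N.
  rewrite -(ler_nat R); apply: le_trans qu _.
  have u4 : u ^+ 4 <= p%:R by rewrite -uT ler_weXn2l // leq_pmulr.
  have p32 : 32 ^+ 2 <= p%:R :> R.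
    rewrite -natrX ler_nat; apply: leq_trans P1p.
    by rewrite /P1 -!addnA addnCA leq_addr.
  rewrite -(@ler_pXn2r _ 2) ?nnegrE ?mulr_ge0 ?sqr_ge0 ?(ltW p_gt0) //.
  rewrite exprMn -exprM [leRHS]expr2.
  by apply: ler_pM => //; rewrite exprn_ge0.
have [sX0 sX1] : 0 < s X /\ s X <= 1 by apply/andP; apply: s01.
have rq : (r_ap m q)%:R <= q%:R * s X.
  apply: le_trans (r_le q pq (le_trans p0X Xq)) _.
  by rewrite ler_pM2l // s_dec.
rewrite leNgt; apply/negP => dense.
have dense_nat : (4 * p * r_ap m q <= q * #|A|)%N.
  rewrite -(ler_nat R) !natrM.
  apply: (@le_trans _ _ (q%:R * (4 * p%:R * s X))); last by rewrite ler_pM2l // ltW.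
  by rewrite mulrCA ler_pM2l // mulr_gt0.
have many := dense_set_many_aps m1 pp pq qp dense_nat.
have r1 := r_ap_gt0 q m1.
have A_ge : (4 * p <= q * #|A|)%N.
  by apply: leq_trans dense_nat; rewrite leq_pmulr.
have Bp : (B < p)%N by apply: leq_trans P1p; rewrite /P1 -!addnA leq_addr.
have := count p pp Bp A noprog.
set a : R := #|A|%:R / p%:R; set N := #|ap_set m A|.
have qa : q%:R^-1 <= a.
  rewrite /a ler_pdivlMr // mulrC ler_pdivrMr // mulrC -natrM ler_nat.
  by apply: leq_trans A_ge; rewrite leq_pmull.
have Na : q%:R^-1 ^+ 3 <= N%:R / p%:R ^+ 2 :> R.
  rewrite ler_pdivlMr ?exprn_gt0 // exprVn mulrC ler_pdivrMr ?exprn_gt0 //.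
  rewrite -!natrX -natrM ler_nat.
  exact: many_aps_cube many A_ge.
move=> small_count; have qinv0 : 0 <= q%:R^-1 :> R by rewrite invr_ge0 ltW.
have Z : (q%:R^-1) ^+ T <= K%:R / p%:R :> R.
  apply: le_trans small_count; rewrite /T exprM.
  have le_kN : q%:R^-1 ^+ (k + 3) <= a ^+ k * (N%:R / p%:R ^+ 2).
    rewrite exprD ler_pM ?exprn_ge0 // lerXn2r ?nnegrE //.
    exact: le_trans qa.
  by rewrite lerXn2r ?nnegrE ?exprn_ge0 // (le_trans _ le_kN) ?exprn_ge0.
have pK : p%:R <= K%:R * q%:R ^+ T :> R.
  by move: Z; rewrite exprVn ler_pdivlMr // mulrC ler_pdivrMr ?exprn_gt0.
have : (p <= K ^ 2 * 32 ^ (2 * T))%N.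
  rewrite -(ler_nat R) natrM !natrX -uT.
  pose v := u ^+ (2 * T); have v0 : 0 < v by rewrite exprn_gt0 // (lt_le_trans ltr01).
  have vE : u ^+ (4 * T) = v ^+ 2 by rewrite -exprM mulnAC.
  have vK : v <= K%:R * 32 ^+ T.
    rewrite -(ler_pM2r v0) -expr2 -vE uT; apply: le_trans pK _.
    rewrite -mulrA ler_wpM2l ?ler0n // /v exprM -exprMn.
    by rewrite lerXn2r ?nnegrE ?(ltW q0) // mulr_ge0 ?sqr_ge0.
  rewrite vE [(2 * T)%N]mulnC exprM -exprMn.
  by rewrite lerXn2r ?nnegrE ?(ltW v0) // (le_trans (ltW v0)).
rewrite leqNgt => /negP; apply; apply: leq_trans P1p; rewrite /P1.
by rewrite addn1 ltnS leq_addl.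
Qed.
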